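(* \textsc{Bicolored $P_3$ Deletion} can be solved in $\mathcal{O}(nm^{3/2})$ time on instances $(G,k)$ where $G$ contains no endangered bicolored $K_3$, where $n=|V|$ and $m=|E|$.
   Context: A two-colored graph $G=(V,E_r,E_b)$ is a finite simple undirected graph whose edge set $E=E_r\uplus E_b$ is partitioned into red edges $E_r$ and blue edges $E_b$. A bicolored $P_3$ is an induced subgraph on three vertices $u,v,w$ such that $\{u,v\}$ and $\{v,w\}$ are edges of different colors and $\{u,w\}$ is not an edge; an edge is part of a bicolored $P_3$ if it is one of its two edges. Three vertices $u,v,w$ form a bicolored $K_3$ if $G[\{u,v,w\}]$ has exactly three edges and exactly two of them have the same color. A bicolored $K_3$ is endangered in $G$ if at least one of its two edges of the same color is part of a bicolored $P_3$ in $G$. \textsc{Bicolored $P_3$ Deletion}: given a two-colored graph $G$ and an integer $k\in\mathbb{N}$, decide whether there is a set $S\subseteq E$ with $|S|\le k$ such that $G-S$ contains no bicolored $P_3$ as an induced subgraph. *)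

(* Defs.v *)
From mathcomp Require Import all_boot.
Set Implicit Arguments. Unset Strict Implicit. Unset Printing Implicit Defensive.

(* An edge (u, v, b) joins u and v; colour b = false is red, b = true blue.*)
Definition edge := (nat * nat * bool)%type.

Definition wf_graph (n : nat) (E : seq edge) : Prop :=
  all (fun e : edge => let: (u, v, _) := e in [&& u < n, v < n & u != v]) E /\
  uniq [seq (let: (u, v, _) := e in (minn u v, maxn u v)) | e : edge <- E].

Definition has_edge (E : seq edge) (u v : nat) (b : bool) : bool :=
  ((u, v, b) \in E) || ((v, u, b) \in E).

Definition is_edge (E : seq edge) (u v : nat) : bool :=
  has_edge E u v false || has_edge E u v true.

Definition bicolored_P3 (E : seq edge) (u v w : nat) : Prop :=
  [/\ u != v, v != w, u != w,
      exists b1 b2, [/\ has_edge E u v b1, has_edge E v w b2 & b1 != b2]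
    & ~~ is_edge E u w].

Definition edge_in_P3 (E : seq edge) (x y : nat) : Prop :=
  exists u v w, bicolored_P3 E u v w /\
    [\/ (x = u /\ y = v), (x = v /\ y = u), (x = v /\ y = w) | (x = w /\ y = v)].

Definition endangered_K3 (E : seq edge) (u v w : nat) : Prop :=
  exists b : bool,
    [/\ u != v, v != w, u != w,
        [/\ has_edge E u v b, has_edge E v w b & has_edge E u w (~~ b)]
      & edge_in_P3 E u v \/ edge_in_P3 E v w].

Definition has_endangered_K3 (E : seq edge) : Prop :=
  exists u v w, endangered_K3 E u v w.

Definition P3_free (E : seq edge) : Prop :=
  forall u v w, ~ bicolored_P3 E u v w.

Definition bp3d_yes (E : seq edge) (k : nat) : Prop :=
  exists S : seq edge,
    [/\ {subset S <= E}, uniq S, size S <= k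
      & P3_free [seq e <- E | e \notin S]].

(* A word-RAM model of computation.                                       *)
(* Memory: nat -> nat, with indirect addressing; unit cost per instruction*)
(* Word size: every value written must be < W (W polynomial in the input). *)
Inductive instr : Type :=
| IConst of nat & nat
| IAdd of nat & nat & nat
| ISub of nat & nat & nat
| IMul of nat & nat & nat
| IDiv of nat & nat & nat
| ILoad of nat & nat
| IStore of nat & nat
| IJz of nat & nat
| IHalt.

Definition upd (M : nat -> nat) (r v : nat) : nat -> nat :=
  fun x => if x == r then v else M x.

Fixpoint exec (P : seq instr) (W t pc : nat) (M : nat -> nat)
  : option (nat -> nat) :=
  match t with
  | 0 => None
  | t'.+1 =>
    let wr r v := if v < W then exec P W t' pc.+1 (upd M r v) else None in
    match nth IHalt P pc with
    | IHalt => Some M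
    | IConst r v => wr r v
    | IAdd r a b => wr r (M a + M b)
    | ISub r a b => wr r (M a - M b)
    | IMul r a b => wr r (M a * M b)
    | IDiv r a b => wr r (M a %/ M b)
    | ILoad r a => wr r (M (M a))
    | IStore a r => wr (M a) (M r)
    | IJz r l => if M r == 0 then exec P W t' l M else exec P W t' pc.+1 M
    end
  end.

(* Input encoding of (G, k) with G = (n, E), m = size E:                 *)
(* M[0] = n, M[1] = m, M[2] = k, and for i < m, with E_i = (u, v, b):     *)
(* M[3+3i] = u, M[4+3i] = v, M[5+3i] = b (0 red, 1 blue); 0 elsewhere.    *)
Definition encode (n : nat) (E : seq edge) (k : nat) : nat -> nat :=
  fun x =>
    if x == 0 then n else if x == 1 then size E else if x == 2 then k else
    let i := (x - 3) %/ 3 in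
    let j := (x - 3) %% 3 in
    if i < size E then
      let: (u, v, b) := nth (0, 0, false) E i in
      if j == 0 then u else if j == 1 then v else nat_of_bool b
    else 0.

(* Main.v *)
(** Deleting the edge [uw] creates a bicolored P3 [u v w] only if [u v w] is a bicolored K3, in which [uw] shares its colour with another edge; if [uw] itself lies on a bicolored P3 then that K3 is endangered. So without endangered K3 a set of edges that all lie on bicolored P3s is a solution as soon as it meets every bicolored P3, i.e. covers the bipartite conflict graph between red and blue edges, and the optimum is the size of a maximum matching there.

The matching is found in O(sqrt m) scans of the O(nm) conflicts. First an auction with integer prices capped at T = sqrt m + 1: every left vertex bids for a neighbour of minimum price and evicts its previous mate, until it is matched or its cheapest neighbour costs T. Each price level then gives a vertex cover, and averaging over the levels shows that the matching is within m/T of the optimum. So at most T further breadth-first searches for augmenting paths suffice, and the last, failing, search yields Koenig's cover.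

The RAM program is compiled from a small while language with scalar variables and interleaved unbounded arrays; a compiler correctness theorem transfers functional specification and step count. *)
Require Import Defs.
From Stdlib Require PeanoNat.
From mathcomp Require Import all_boot zify.
Set Implicit Arguments. Unset Strict Implicit. Unset Printing Implicit Defensive.

(** * A while language compiled to the word RAM *)

(** The cap T balances the two phases: the auction makes O(nmT) moves and leaves a deficit of at
    most m/T, and each later search repairs one unit in O(nm) steps; with m < T^2 both phases stay
    within O(nm sqrt m). The auction suits a formal count well: all its moves are charged to one
    potential that grows by exactly one per move, so no phases of disjoint shortest paths have to be
    analysed.

    The conflict table has 2n slots per edge because a conflict partner of an edge is determined by
    the shared endpoint and the third vertex.

    The machine shapes the rest. The input starts at cell 0 and occupies the cells a program would
    use as registers, so its first cells must be moved away before anything else, with the cells of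
    n and m as work space. Memory beyond the input is zero, which gives an adjacency matrix of n^2
    cells for free; clearing it would exceed the time bound when m is small. Every written value,
    addresses included, must fit into a word, so the semantics of the language carries overflow
    conditions. *)

Arguments upd : simpl never.

(* Memory layout: cells [0..23] hold the program variables, cell 24 the base [B] of the arrays, cells [25..39] are temporaries, and entry [i] of array [a] is cell [B + 16 i + a]. Between cell 40 and [B] lies the unmoved rest of the input, which [Raw] reads. *)
Definition base_reg := 24.
Definition tmp := base_reg.+1.
Definition nregs := 40.
Definition stride := 16.

Inductive binop := OAdd | OSub | OMul | ODiv.

Inductive expr :=
| Cst of nat
| Var of nat
| Arr of nat & expr
| Raw of expr
| Bin of binop & expr & expr.

Inductive cmd :=
| Skip
| Asg of nat & expr
| Sto of nat & expr & expr
| Seq of cmd & cmd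
| If of expr & cmd & cmd
| While of expr & cmd.

Record state := State { vr : nat -> nat; ar : nat -> nat -> nat }.

Definition setv (s : state) (x v : nat) : state :=
  State (fun y => if Nat.eqb y x then v else vr s y) (ar s).

Definition seta (s : state) (a i v : nat) : state :=
  State (vr s) (fun b => if Nat.eqb b a then upd (ar s b) i v else ar s b).

Definition den (o : binop) : nat -> nat -> nat :=
  match o with OAdd => addn | OSub => subn | OMul => muln | ODiv => divn end.

Lemma updE M r v x : upd M r v x = if x == r then v else M x.
Proof. by []. Qed.

Lemma upd_same M r v : upd M r v r = v.
Proof. by rewrite updE eqxx. Qed.

Lemma upd_other M r v x : x <> r -> upd M r v x = M x.
Proof. by rewrite updE; case: eqP. Qed.

Definition ieff (i : instr) (M : nat -> nat) : option (nat * nat) :=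
  match i with
  | IConst r v => Some (r, v)
  | IAdd r a b => Some (r, M a + M b)
  | ISub r a b => Some (r, M a - M b)
  | IMul r a b => Some (r, M a * M b)
  | IDiv r a b => Some (r, M a %/ M b)
  | ILoad r a => Some (r, M (M a))
  | IStore a r => Some (M a, M r)
  | _ => None
  end.

Fixpoint run_line (W : nat) (c : seq instr) (M : nat -> nat) : option (nat -> nat) :=
  if c is i :: c' then
    if ieff i M is Some (r, v) then
      if v < W then run_line W c' (upd M r v) else None
    else None
  else Some M.

Lemma run_line_cat W c1 c2 M :
  run_line W (c1 ++ c2) M = obind (run_line W c2) (run_line W c1 M).
Proof.
elim: c1 M => //= i c1 IH M; case: (ieff i M) => // -[r v].
by case: ifP.
Qed.

Definition code_at (P : seq instr) (pc : nat) (c : seq instr) : Prop :=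
  forall i, i < size c -> nth IHalt P (pc + i) = nth IHalt c i.

Lemma code_at_cat P pc c1 c2 :
  code_at P pc (c1 ++ c2) <-> code_at P pc c1 /\ code_at P (pc + size c1) c2.
Proof.
split=> [H|[H1 H2] i].
- split=> i Hi.
  + by rewrite H ?nth_cat ?Hi // size_cat; lia.
  + rewrite -addnA H ?size_cat ?ltn_add2l // nth_cat ifF; last by lia.
    by rewrite addKn.
- rewrite size_cat nth_cat => Hi; case: ltnP => H; first exact: H1.
  by rewrite -(subnKC H) addnA H2 ?addKn //; lia.
Qed.

(** The remaining fuel [t'] is quantified, so fragments compose by adding their step counts, and
    halting enters only at the very end. *)
Definition steps (P : seq instr) (W t pc : nat) (M : nat -> nat)
    (pc' : nat) (M' : nat -> nat) : Prop :=
  forall t', exec P W (t + t') pc M = exec P W t' pc' M'.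

Lemma steps_trans P W t1 t2 pc1 pc2 pc3 M1 M2 M3 :
  steps P W t1 pc1 M1 pc2 M2 -> steps P W t2 pc2 M2 pc3 M3 ->
  steps P W (t1 + t2) pc1 M1 pc3 M3.
Proof. by move=> H1 H2 t'; rewrite -addnA H1 H2. Qed.

Lemma steps_line P W pc c M M' :
  code_at P pc c -> run_line W c M = Some M' ->
  steps P W (size c) pc M (pc + size c) M'.
Proof.
elim: c pc M => [|i c IH] pc M Hc /=; first by move=> [<-] t'; rewrite addn0.
have Hi := Hc 0 isT; rewrite addn0 /= in Hi.
have Hc' : code_at P pc.+1 c by move=> j Hj; rewrite addSnnS Hc.
case E: (ieff i M) => [[r v]|//]; case: ifP => // Hv /(IH _ _ Hc') H t'.
rewrite /= Hi -addSnnS -H.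
by case: i E {Hi Hc} => //= *;
  match goal with H : Some _ = Some _ |- _ => case: H => -> -> end; rewrite Hv.
Qed.

Lemma steps_jz P W pc r l M :
  nth IHalt P pc = IJz r l ->
  steps P W 1 pc M (if M r == 0 then l else pc.+1) M.
Proof. by move=> H t'; rewrite /= H; case: ifP. Qed.

Definition caddr (a d : nat) : seq instr :=
  [:: IConst d.+1 stride; IMul d d d.+1; IConst d.+1 a; IAdd d d d.+1; IAdd d d base_reg].

Definition cop (o : binop) (d : nat) : instr :=
  match o with
  | OAdd => IAdd d d d.+1
  | OSub => ISub d d d.+1
  | OMul => IMul d d d.+1
  | ODiv => IDiv d d d.+1
  end.

(** Stack discipline: the value lands in cell [d], cells below [d] survive, cells above are scratch.
    [dep] below counts the cells used. *)
Fixpoint cexp (e : expr) (d : nat) : seq instr :=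
  match e with
  | Cst n => [:: IConst d n]
  | Var x => [:: IConst d 0; IAdd d d x]
  | Arr a e => cexp e d ++ caddr a d ++ [:: ILoad d d]
  | Raw e => cexp e d ++ [:: ILoad d d]
  | Bin o e1 e2 => cexp e1 d ++ cexp e2 d.+1 ++ [:: cop o d]
  end.

Definition esz (e : expr) : nat := size (cexp e tmp).

Lemma size_cexp e d : size (cexp e d) = esz e.
Proof.
have : forall d', size (cexp e d) = size (cexp e d'); last by apply.
elim: e d => //= [a e IH|e IH|o e1 IH1 e2 IH2] d d'; rewrite !size_cat /=.
- by rewrite (IH d d').
- by rewrite (IH d d').
- by rewrite (IH1 d d') (IH2 d.+1 d'.+1).
Qed.

Fixpoint dep (e : expr) : nat :=
  match e with
  | Cst _ | Var _ => 1
  | Arr _ e => maxn (dep e) 2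
  | Raw e => dep e
  | Bin _ e1 e2 => maxn (dep e1) (dep e2).+1
  end.

Fixpoint wfe (e : expr) : bool :=
  match e with
  | Cst _ => true
  | Var x => x < base_reg
  | Arr a e => (a < stride) && wfe e
  | Raw e => wfe e
  | Bin _ e1 e2 => wfe e1 && wfe e2
  end.

(** The bound 12 keeps an expression evaluated at [tmp] or [tmp.+1] inside the temporaries. *)
Definition wfx (e : expr) : bool := wfe e && (dep e <= 12).

Fixpoint wfc (c : cmd) : bool :=
  match c with
  | Skip => true
  | Asg x e => (x < base_reg) && wfx e
  | Sto a e1 e2 => [&& a < stride, wfx e1 & wfx e2]
  | Seq c1 c2 => wfc c1 && wfc c2
  | If e c1 c2 => [&& wfx e, wfc c1 & wfc c2]
  | While e c => wfx e && wfc c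
  end.

(** Jumps are absolute, hence the argument [pc]. The pair [IConst tmp 0; IJz tmp l] is an
    unconditional jump; it explains the offsets [+ 2] and, together with the test, the charge 3 in
    [ev] for a branch ending with it. *)
Fixpoint ccmd (c : cmd) (pc : nat) : seq instr :=
  match c with
  | Skip => [::]
  | Asg x e => cexp e tmp ++ [:: IConst tmp.+1 0; IAdd x tmp tmp.+1]
  | Sto a e1 e2 =>
      cexp e1 tmp ++ caddr a tmp ++ cexp e2 tmp.+1 ++ [:: IStore tmp tmp.+1]
  | Seq c1 c2 =>
      let k1 := ccmd c1 pc in k1 ++ ccmd c2 (pc + size k1)
  | If e c1 c2 =>
      let k1 := ccmd c1 (pc + esz e + 1) in
      let p2 := pc + esz e + 1 + size k1 + 2 in
      let k2 := ccmd c2 p2 in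
      cexp e tmp ++ [:: IJz tmp p2] ++ k1 ++ [:: IConst tmp 0; IJz tmp (p2 + size k2)]
        ++ k2
  | While e c =>
      let k := ccmd c (pc + esz e + 1) in
      cexp e tmp ++ [:: IJz tmp (pc + esz e + 1 + size k + 2)] ++ k
        ++ [:: IConst tmp 0; IJz tmp pc]
  end.

(** * Semantics with step counts, and compiler correctness *)

Section Language.
Context (W V B : nat) (raw : nat -> nat).

Fixpoint eval (s : state) (e : expr) : nat :=
  match e with
  | Cst n => n
  | Var x => vr s x
  | Arr a e => ar s a (eval s e)
  | Raw e => raw (eval s e)
  | Bin o e1 e2 => den o (eval s e1) (eval s e2)
  end.

(* No intermediate value overflows [V], and raw reads stay inside the input area. *)
Fixpoint safe (s : state) (e : expr) : Prop :=
  match e with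
  | Cst n => n < V
  | Var x => True
  | Arr a e => safe s e
  | Raw e => safe s e /\ nregs <= eval s e < B
  | Bin OAdd e1 e2 => safe s e1 /\ safe s e2 /\ eval s e1 + eval s e2 < V
  | Bin OMul e1 e2 => safe s e1 /\ safe s e2 /\ eval s e1 * eval s e2 < V
  | Bin _ e1 e2 => safe s e1 /\ safe s e2
  end.

Inductive ev : cmd -> state -> nat -> state -> Prop :=
| ev_skip s : ev Skip s 0 s
| ev_asg x e s : safe s e -> ev (Asg x e) s (esz e + 2) (setv s x (eval s e))
| ev_sto a e1 e2 s : safe s e1 -> safe s e2 ->
    ev (Sto a e1 e2) s (esz e1 + esz e2 + 6) (seta s a (eval s e1) (eval s e2))
| ev_seq c1 c2 s1 s2 s3 t1 t2 :
    ev c1 s1 t1 s2 -> ev c2 s2 t2 s3 -> ev (Seq c1 c2) s1 (t1 + t2) s3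
| ev_if1 e c1 c2 s s' t : safe s e -> eval s e <> 0 -> ev c1 s t s' ->
    ev (If e c1 c2) s (esz e + t + 3) s'
| ev_if0 e c1 c2 s s' t : safe s e -> eval s e = 0 -> ev c2 s t s' ->
    ev (If e c1 c2) s (esz e + t + 1) s'
| ev_while0 e c s : safe s e -> eval s e = 0 -> ev (While e c) s (esz e + 1) s
| ev_whileS e c s1 s2 s3 t1 t2 : safe s1 e -> eval s1 e <> 0 ->
    ev c s1 t1 s2 -> ev (While e c) s2 t2 s3 ->
    ev (While e c) s1 (esz e + t1 + 3 + t2) s3.

Record rel (s : state) (M : nat -> nat) : Prop := Rel {
  rel_var : forall x, x < base_reg -> M x = vr s x;
  rel_base : M base_reg = B;
  rel_arr : forall a i, a < stride -> M (i * stride + a + B) = ar s a i;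
  rel_raw : forall x, nregs <= x < B -> M x = raw x;
  rel_varV : forall x, x < base_reg -> vr s x < V;
  rel_arrV : forall a i, a < stride -> ar s a i < V;
  rel_rawV : forall x, nregs <= x < B -> raw x < V
}.

(** An array index is a value below [V], so the last bound makes every array address a legal
    word. *)
Context (B_large : nregs <= B) (V_large : stride < V) (W_large : V * stride + stride + B < W).

Lemma rel_temp s M d v : rel s M -> base_reg < d < nregs -> rel s (upd M d v).
Proof.
move=> [h1 h2 h3 h4 h5 h6 h7] Hd.
have Hd' := Hd; move: Hd' B_large; rewrite /base_reg /nregs => Hd' HB.
split=> // [x Hx| |a i Ha|x Hx].
- by rewrite upd_other ?h1 //; move: Hx; rewrite /base_reg; lia.
- by rewrite upd_other ?h2 // /base_reg; lia.
- by rewrite upd_other ?h3 //; lia.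
- by rewrite upd_other ?h4 //; move: Hx; rewrite /nregs; lia.
Qed.

Lemma eval_lt s M e : rel s M -> wfe e -> safe s e -> eval s e < V.
Proof.
move=> R; elim: e => //= [x Hx _|a e IH /andP[Ha _] _|e IH He [Hs Hr]|o e1 IH1 e2 IH2].
- exact: rel_varV R _ Hx.
- exact: rel_arrV R _ _ Ha.
- exact: rel_rawV R _ Hr.
case: o => /= /andP[H1 H2]; try by case=> ? [].
- by case=> /(IH1 H1) Hs1 _; apply: leq_ltn_trans Hs1; apply: leq_subr.
- by case=> /(IH1 H1) Hs1 _; apply: leq_ltn_trans Hs1; apply: leq_div.
Qed.

Lemma V_W v : v < V -> v < W.
Proof. by move: W_large; rewrite /stride; lia. Qed.

Lemma run_caddr s M a d :
  rel s M -> a < stride -> base_reg < d -> d.+1 < nregs -> M d < V ->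
  exists M', [/\ run_line W (caddr a d) M = Some M', rel s M',
    M' d = M d * stride + a + B & forall x, x < d -> M' x = M x].
Proof.
move=> R Ha Hd Hd2 HM; rewrite /caddr /=.
have Hne : d <> d.+1 by lia.
have HNd : base_reg <> d by lia.
have HNd' : base_reg <> d.+1 by lia.
have WK : stride < W by exact: V_W.
have H2 : M d * stride < W by move: W_large; rewrite /stride; lia.
have H3 : M d * stride + a < W by move: W_large Ha; rewrite /stride; lia.
have H4 : M d * stride + a + B < W by move: W_large Ha; rewrite /stride; lia.
rewrite WK !upd_same (upd_other _ _ Hne) H2 (V_W (ltn_trans Ha V_large)).
rewrite !(upd_other _ _ Hne) !upd_same H3.
rewrite !(upd_other _ _ HNd) !(upd_other _ _ HNd') (upd_other _ _ HNd) (upd_other _ _ HNd').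
rewrite (rel_base R) H4.
eexists; split; first reflexivity.
- by do 5 (apply: rel_temp; last lia).
- by rewrite upd_same.
- by move=> x Hx; rewrite !upd_other //; lia.
Qed.

Lemma run_cexp s e : wfe e -> safe s e -> forall M d,
  rel s M -> base_reg < d -> d + dep e < nregs ->
  exists M', [/\ run_line W (cexp e d) M = Some M', rel s M',
    M' d = eval s e & forall x, x < d -> M' x = M x].
Proof.
elim: e => [n|x|a e IH|e IH|o e1 IH1 e2 IH2] Hwf Hsafe M d R Hd Hdep /=;
  have HevV := eval_lt R Hwf Hsafe; have HevW := V_W HevV;
  simpl in Hwf, Hsafe, Hdep, HevV, HevW.
- rewrite HevW; eexists; split; first reflexivity.
  + by apply: rel_temp => //; lia.
  + by rewrite upd_same.
  + by move=> x Hx; rewrite upd_other //; lia.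
- have W0 : 0 < W by lia.
  have Hxd : x <> d by lia.
  rewrite W0 upd_same (upd_other _ _ Hxd) add0n (rel_var R) // HevW.
  eexists; split; first reflexivity.
  + by do 2 (apply: rel_temp; last lia).
  + by rewrite upd_same.
  + by move=> y Hy; rewrite !upd_other //; lia.
- case/andP: Hwf => Ha He.
  have [|M1 [E1 R1 V1 P1]] := IH He Hsafe M d R Hd; first by lia.
  have V1' : M1 d < V by rewrite V1; exact: eval_lt R He Hsafe.
  have [|M2 [E2 R2 V2 P2]] := run_caddr R1 Ha Hd _ V1'; first by lia.
  rewrite run_line_cat E1 -[obind _ _]/(run_line W (caddr a d ++ [:: ILoad d d]) M1).
  rewrite run_line_cat E2 /= V2 V1 (rel_arr R2) // HevW.
  eexists; split; first reflexivity.
  + by apply: rel_temp => //; lia.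
  + by rewrite upd_same.
  + by move=> y Hy; rewrite upd_other ?P2 ?P1 //; lia.
- case: Hsafe => Hsafe Hr.
  have [|M1 [E1 R1 V1 P1]] := IH Hwf Hsafe M d R Hd; first by lia.
  rewrite !run_line_cat E1 /= V1 (rel_raw R1) // HevW.
  eexists; split; first reflexivity.
  + by apply: rel_temp => //; lia.
  + by rewrite upd_same.
  + by move=> y Hy; rewrite upd_other ?P1 //; lia.
- case/andP: Hwf => H1 H2.
  have [S1 S2] : safe s e1 /\ safe s e2.
    by case: (o) Hsafe => /=; try by []; case=> ? [].
  have [|M1 [E1 R1 V1 P1]] := IH1 H1 S1 M d R Hd; first by lia.
  have [||M2 [E2 R2 V2 P2]] := IH2 H2 S2 M1 d.+1 R1; [by lia|by lia|].
  have V1' : M2 d = eval s e1 by rewrite P2.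
  rewrite !run_line_cat E1 /= run_line_cat E2 /=.
  have -> : ieff (cop o d) M2 = Some (d, den o (eval s e1) (eval s e2)).
    by case: (o) => /=; rewrite V1' V2.
  rewrite HevW; eexists; split; first reflexivity.
  + by apply: rel_temp => //; lia.
  + by rewrite upd_same.
  + by move=> y Hy; rewrite upd_other ?P2 ?P1 //; lia.
Qed.


Lemma ccmd_correct P c s t s' :
  ev c s t s' -> wfc c -> forall pc M, code_at P pc (ccmd c pc) -> rel s M ->
  exists M', steps P W t pc M (pc + size (ccmd c pc)) M' /\ rel s' M'.
Proof.
have W0 : 0 < W by move: V_large; rewrite /stride; have := V_W; lia.
have HT : base_reg < tmp by [].
have test e s0 : wfx e -> safe s0 e -> forall pc M c',
    code_at P pc (cexp e tmp ++ c') -> rel s0 M ->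
    exists M', [/\ steps P W (esz e) pc M (pc + esz e) M', rel s0 M',
      M' tmp = eval s0 e & code_at P (pc + esz e) c'].
  move=> /andP[We De] He pc M c' /code_at_cat[C1 C2] R.
  have [|M1 [E1 R1 V1 P1]] := run_cexp We He R HT; first by rewrite /tmp /base_reg /nregs; lia.
  exists M1; split=> //; first exact: steps_line C1 E1.
elim=> {c s t s'} [s|x e s He|a e1 e2 s He1 He2|c1 c2 s1 s2 s3 t1 t2 _ IH1 _ IH2
  |e c1 c2 s s' t He Hv _ IH|e c1 c2 s s' t He Hv _ IH|e c s He Hv
  |e c s1 s2 s3 t1 t2 He Hv _ IH1 _ IH2] Wf pc M C R.
- by exists M; split=> //; rewrite addn0 => t'.
- move: Wf => /= /andP[Hx Wx].
  have [M1 [S1 R1 V1 C1]] := test _ _ Wx He _ _ _ C R.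
  have HV := eval_lt R (proj1 (andP Wx)) He.
  have Hrun : run_line W [:: IConst tmp.+1 0; IAdd x tmp tmp.+1] M1 =
      Some (upd (upd M1 tmp.+1 0) x (eval s e)).
    by rewrite /= W0 upd_same upd_other // addn0 V1 V_W.
  exists (upd (upd M1 tmp.+1 0) x (eval s e)); split.
    have := steps_trans S1 (steps_line C1 Hrun).
    by rewrite /= size_cat size_cexp /= addnA.
  have R2 : rel s (upd M1 tmp.+1 0) by apply: rel_temp.
  move: R2 => [h1 h2 h3 h4 h5 h6 h7].
  split=> // [y Hy| |a i Ha|y Hy|y Hy].
  + rewrite /= updE h1 //; case: PeanoNat.Nat.eqb_spec; case: eqP => //; congruence.
  + by rewrite upd_other ?h2 //; lia.
  + rewrite upd_other ?h3 //; move: Hx B_large; rewrite /base_reg /nregs; lia.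
  + rewrite upd_other ?h4 //; move: Hx Hy; rewrite /base_reg /nregs; lia.
  + by rewrite /=; case: PeanoNat.Nat.eqb_spec => // _; exact: h5.
- move: Wf => /= /and3P[Ha W1 W2].
  have [M1 [S1 R1 V1 C1]] := test _ _ W1 He1 _ _ _ C R.
  have HV1 := eval_lt R (proj1 (andP W1)) He1.
  have HV2 := eval_lt R (proj1 (andP W2)) He2.
  have [||M2 [E2 R2 V2 P2]] := run_caddr R1 Ha HT; [by []|by rewrite V1|].
  have [||M3 [E3 R3 V3 P3]] := run_cexp (proj1 (andP W2)) He2 R2 (d := tmp.+1);
    [by []|by move: (proj2 (andP W2)); rewrite /tmp /base_reg /nregs; lia|].
  have VA : M3 tmp = eval s e1 * stride + a + B by rewrite P3 // V2 V1.
  have Hrun : run_line W (caddr a tmp ++ cexp e2 tmp.+1 ++ [:: IStore tmp tmp.+1]) M1 =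
      Some (upd M3 (eval s e1 * stride + a + B) (eval s e2)).
    by rewrite run_line_cat E2 /= run_line_cat E3 /= VA V3 V_W.
  exists (upd M3 (eval s e1 * stride + a + B) (eval s e2)); split.
    have := steps_trans S1 (steps_line C1 Hrun).
    do 3 rewrite /= ?size_cat ?size_cexp.
    by congr steps; lia.
  move: R3 => [h1 h2 h3 h4 h5 h6 h7].
  split=> // [y Hy| |b i Hb|y Hy|b i Hb].
  + by rewrite upd_other ?h1 //; move: Hy B_large; rewrite /base_reg /nregs; lia.
  + by rewrite upd_other ?h2 //; move: B_large; rewrite /base_reg /nregs; lia.
  (* An address determines both array and index, since array numbers are below [stride]. *)
  + rewrite /= updE h3 //; case: PeanoNat.Nat.eqb_spec => [->|Hab]; rewrite ?updE.
    * by case: eqP; case: eqP => //; rewrite /stride; lia.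
    * by case: eqP => // He; case: Hab; move: He Ha Hb; rewrite /stride; lia.
  + by rewrite upd_other ?h4 //; lia.
  + rewrite /=; case: PeanoNat.Nat.eqb_spec => _; rewrite ?updE; last exact: h6.
    by case: eqP => _ //; exact: h6.
- move: Wf => /= /andP[W1 W2]; move: C => /= /code_at_cat[C1 C2].
  have [M1 [S1 R1]] := IH1 W1 _ _ C1 R.
  have [M2 [S2 R2]] := IH2 W2 _ _ C2 R1.
  by exists M2; split=> //; rewrite /= size_cat addnA; exact: steps_trans S1 S2.
- move: Wf => /= /and3P[Wx W1 W2]; move: C => /=.
  set p2 := pc + _ + _ + _ + 2 => C.
  have [M1 [S1 R1 V1 C1]] := test _ _ Wx He _ _ _ C R.
  move/code_at_cat: (C1 : code_at _ _ ([:: _] ++ _ ++ _)) => [J1].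
  move=> /code_at_cat[C2] /(code_at_cat _ _ [:: _; _])[C3 _].
  have J := steps_jz W M1 (l := p2) (J1 0 isT); rewrite addn0 in J.
  rewrite V1 (introF eqP Hv) -[(pc + _).+1]addn1 in J.
  have [M2 [S2 R2]] := IH W1 _ _ C2 R1.
  have S3 : steps P W 1 (pc + esz e + 1 + size (ccmd c1 (pc + esz e + 1))) M2
      (pc + esz e + 1 + size (ccmd c1 (pc + esz e + 1)) + 1) (upd M2 tmp 0).
    apply: (@steps_line _ _ _ [:: IConst tmp 0]); last by rewrite /= W0.
    by case=> // _; exact: C3 0 isT.
  have := steps_jz W (upd M2 tmp 0) (C3 1 isT); rewrite upd_same eqxx => S4.
  exists (upd M2 tmp 0); split; last by apply: rel_temp.
  have := steps_trans S1 (steps_trans J (steps_trans S2 (steps_trans S3 S4))).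
  do 3 rewrite /= ?size_cat ?size_cexp; rewrite /p2; congr steps; lia.
- move: Wf => /= /and3P[Wx W1 W2]; move: C => /=.
  set p2 := pc + _ + _ + _ + 2 => C.
  have [M1 [S1 R1 V1 C1]] := test _ _ Wx He _ _ _ C R.
  move/code_at_cat: (C1 : code_at _ _ ([:: _] ++ _ ++ _)) => [J1].
  move=> /code_at_cat[C2] /(code_at_cat _ _ [:: _; _])[C3 C4].
  have J := steps_jz W M1 (l := p2) (J1 0 isT); rewrite addn0 in J.
  rewrite V1 Hv eqxx in J.
  have [M2 [S2 R2]] := IH W2 _ _ C4 R1.
  exists M2; split=> //.
  have := steps_trans S1 (steps_trans J S2).
  do 3 rewrite /= ?size_cat ?size_cexp; rewrite /p2; congr steps; lia.
- move: Wf => /= /andP[Wx W1]; move: C => /= C.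
  have [M1 [S1 R1 V1 C1]] := test _ _ Wx He _ _ _ C R.
  have := steps_jz W M1 (C1 0 isT); rewrite addn0 V1 Hv eqxx => J.
  exists M1; split=> //.
  have := steps_trans S1 J; do 3 rewrite /= ?size_cat ?size_cexp.
  congr steps; lia.
- move: (Wf) => /= /andP[Wx W1]; move: (C) => /= C'.
  have [M1 [S1 R1 V1 C1]] := test _ _ Wx He _ _ _ C' R.
  move/code_at_cat: (C1 : code_at _ _ ([:: _] ++ _ ++ _)) => [J1].
  move=> /code_at_cat[C2 C3].
  have := steps_jz W M1 (J1 0 isT).
  rewrite addn0 V1 (introF eqP Hv) -[(pc + _).+1]addn1 => J.
  have [M2 [S2 R2]] := IH1 W1 _ _ C2 R1.
  set p := pc + esz e + 1 in S2 C3 C2 J *.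
  have S3 : steps P W 1 (p + size (ccmd c p)) M2
      (p + size (ccmd c p) + 1) (upd M2 tmp 0).
    apply: (@steps_line _ _ _ [:: IConst tmp 0]); last by rewrite /= W0.
    by case=> // _; exact: C3 0 isT.
  have := steps_jz W (upd M2 tmp 0) (C3 1 isT); rewrite upd_same eqxx => S4.
  have R3 : rel s2 (upd M2 tmp 0) by apply: rel_temp.
  have [M3 [S5 R4]] := IH2 Wf _ _ C R3.
  exists M3; split=> //.
  have := steps_trans S1 (steps_trans J (steps_trans S2
    (steps_trans S3 (steps_trans S4 S5)))).
  congr steps; lia.
Qed.

End Language.

(** * Program logic with time bounds *)

Section Logic.
Context (V B : nat) (raw : nat -> nat).
Local Notation eval := (eval raw).
Local Notation safe := (safe V B raw).
Local Notation ev := (ev V B raw).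

Definition spec (c : cmd) (s : state) (t : nat) (Q : state -> Prop) : Prop :=
  exists t' s', [/\ ev c s t' s', t' <= t & Q s'].

Lemma spec_seq c1 c2 s t1 t2 Q R :
  spec c1 s t1 R -> (forall s', R s' -> spec c2 s' t2 Q) ->
  spec (Seq c1 c2) s (t1 + t2) Q.
Proof.
move=> [t1' [s1 [E1 H1 HR]]] H; have [t2' [s2 [E2 H2 HQ]]] := H _ HR.
by exists (t1' + t2'), s2; split=> //; [exact: ev_seq E1 E2|exact: leq_add].
Qed.

Lemma spec_weaken c s t t' (Q Q' : state -> Prop) :
  spec c s t Q -> t <= t' -> (forall s', Q s' -> Q' s') -> spec c s t' Q'.
Proof.
move=> [u [s' [E Hu HQ]]] Ht H; exists u, s'.
by split=> //; [exact: leq_trans Ht|exact: H].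
Qed.

(** The extra unit added to the variant pays for the failing last test. The cost of every loop is
    thus read off its variant and a uniform bound on one pass. *)
Lemma spec_while e c b (I Q : state -> Prop) (mu : state -> nat) s :
  (forall s, I s -> safe s e) ->
  (forall s, I s -> eval s e = 0 -> Q s) ->
  (forall s, I s -> eval s e <> 0 -> spec c s b (fun s' => I s' /\ mu s' < mu s)) ->
  I s -> spec (While e c) s ((mu s).+1 * (esz e + b + 3)) Q.
Proof.
move=> Hsafe Hexit Hstep.
move: {2}(mu s).+1 (ltnSn (mu s)) => n; elim: n s => // n IH s Hn Is.
have [E|E] := eqVneq (eval s e) 0.
  exists (esz e + 1), s; split; [by apply: ev_while0; auto|lia|exact: Hexit].
have [t1 [s1 [E1 H1 [I1 D1]]]] := Hstep s Is (elimN eqP E).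
have [|t2 [s2 [E2 H2 Q2]]] := IH s1 _ I1; first by lia.
exists (esz e + t1 + 3 + t2), s2; split=> //.
  by apply: ev_whileS E1 E2; [exact: Hsafe|exact/eqP].
apply: (@leq_trans (esz e + b + 3 + (mu s1).+1 * (esz e + b + 3))).
  by apply: leq_add => //; lia.
by rewrite -mulSn leq_mul2r; apply/orP; right.
Qed.

Lemma spec_if e c1 c2 s t Q :
  safe s e -> (eval s e <> 0 -> spec c1 s t Q) -> (eval s e = 0 -> spec c2 s t Q) ->
  spec (If e c1 c2) s (esz e + t + 3) Q.
Proof.
move=> He H1 H2; have [E|/eqP E] := eqVneq (eval s e) 0.
  have [u [s' [Eu Hu HQ]]] := H2 E.
  by exists (esz e + u + 1), s'; split=> //; [exact: ev_if0|lia].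
have [u [s' [Eu Hu HQ]]] := H1 E.
by exists (esz e + u + 3), s'; split=> //; [exact: ev_if1|lia].
Qed.

(** Straight-line code is verified by computing [wp]; loops go to [False] because they are treated
    by [spec_while] only. *)
Fixpoint wp (c : cmd) (s : state) (Q : state -> Prop) : Prop :=
  match c with
  | Skip => Q s
  | Asg x e => safe s e /\ Q (setv s x (eval s e))
  | Sto a e1 e2 => [/\ safe s e1, safe s e2 & Q (seta s a (eval s e1) (eval s e2))]
  | Seq c1 c2 => wp c1 s (fun s1 => wp c2 s1 Q)
  | If e c1 c2 =>
      [/\ safe s e, eval s e <> 0 -> wp c1 s Q & eval s e = 0 -> wp c2 s Q]
  | While _ _ => False
  end.

Fixpoint tc (c : cmd) : nat :=
  match c with
  | Skip => 0
  | Asg _ e => esz e + 2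
  | Sto _ e1 e2 => esz e1 + esz e2 + 6
  | Seq c1 c2 => tc c1 + tc c2
  | If e c1 c2 => esz e + maxn (tc c1) (tc c2) + 3
  | While _ _ => 0
  end.

Lemma wp_spec c s Q : wp c s Q -> spec c s (tc c) Q.
Proof.
elim: c s Q => //= [|x e|a e1 e2|c1 IH1 c2 IH2|e c1 IH1 c2 IH2] s Q.
- by move=> HQ; exists 0, s; split=> //; exact: ev_skip.
- by case=> He HQ; exists (esz e + 2), (setv s x (eval s e)); split=> //; exact: ev_asg.
- case=> He1 He2 HQ; exists (esz e1 + esz e2 + 6).
  by exists (seta s a (eval s e1) (eval s e2)); split=> //; exact: ev_sto.
- by move/IH1 => H1; apply: spec_seq H1 _ => s'; exact: IH2.
- case=> He H1 H2; apply: spec_if => // [/H1/IH1|/H2/IH2] H;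
    apply: spec_weaken H _ _ => //; lia.
Qed.

End Logic.

(** * Auction *)

Definition sm (m : nat) (F : nat -> nat) : nat := \sum_(1 <= i < m.+1) F i.

Lemma sm_upd m F G u :
  0 < u <= m -> (forall i, i <> u -> F i = G i) -> sm m F + G u = sm m G + F u.
Proof.
move=> Hu H; rewrite /sm.
have Hin : u \in index_iota 1 m.+1 by rewrite mem_index_iota; lia.
rewrite (bigD1_seq u) ?iota_uniq //= [in RHS](bigD1_seq u) ?iota_uniq //=.
rewrite (eq_bigr G); first by lia.
by move=> i /eqP; exact: H.
Qed.

Lemma sm_le m F G : (forall i, 0 < i <= m -> F i <= G i) -> sm m F <= sm m G.
Proof. by move=> H; rewrite /sm !big_nat; apply: leq_sum => i Hi; apply: H; lia. Qed.

Lemma sm_const m c : sm m (fun _ => c) = m * c.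
Proof. by rewrite /sm sum_nat_const_nat subn1. Qed.

Lemma sm_add m F G : sm m (fun i => F i + G i) = sm m F + sm m G.
Proof. exact: big_split. Qed.

Lemma sm_count m (p : pred nat) : sm m (fun i => p i : nat) = count p (iota 1 m).
Proof.
rewrite /sm -sum1_count [RHS]big_mkcond /index_iota subSS subn0.
by apply: eq_bigr => i _; case: (p i).
Qed.

Lemma count_inj m (p q : pred nat) (f : nat -> nat) :
  (forall u, 0 < u <= m -> p u -> 0 < f u <= m /\ q (f u)) ->
  (forall u v, 0 < u <= m -> 0 < v <= m -> p u -> p v -> f u = f v -> u = v) ->
  count p (iota 1 m) <= count q (iota 1 m).
Proof.
move=> Hf Hinj; rewrite -!size_filter -(size_map f).
have Hio u : (u \in iota 1 m) = (0 < u <= m) by rewrite mem_iota; lia.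
apply: uniq_leq_size.
  rewrite map_inj_in_uniq ?filter_uniq ?iota_uniq // => u v.
  by rewrite !mem_filter !Hio => /andP[? ?] /andP[? ?]; exact: Hinj.
move=> x /mapP[u]; rewrite mem_filter Hio => /andP[pu Hu] ->.
by rewrite mem_filter Hio; case: (Hf u Hu pu) => -> ->.
Qed.

Section Matching.
Context (nb : nat -> nat) (D m : nat).

(** Both sides number their vertices 1..m; [nb] holds [D] slots per left vertex, and 0 is an empty
    slot. *)
Definition arc (u x : nat) : Prop := x <> 0 /\ exists2 j, j < D & nb (u * D + j) = x.

Context (nb_le : forall u j, 0 < u <= m -> j < D -> nb (u * D + j) <= m).

Lemma arc_range u x : 0 < u <= m -> arc u x -> 0 < x <= m.
Proof. by move=> Hu [x0 [j Hj E]]; have := nb_le Hu Hj; lia. Qed.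

(* [mL] and [mR] are mutually inverse partial maps (0 = unmatched) made of arcs, except that [mR h] may be stale at the hole [h], which no left vertex uses; [h = 0] means no hole. *)
Record matching (h : nat) (mL mR : nat -> nat) : Prop := Matching {
  matchL : forall u, 0 < u <= m -> mL u <> 0 ->
    [/\ arc u (mL u), mR (mL u) = u & mL u <> h];
  matchR : forall x, 0 < x <= m -> x <> h -> mR x <> 0 ->
    0 < mR x <= m /\ mL (mR x) = x
}.

Definition msize (mL : nat -> nat) : nat := count (fun u => mL u != 0) (iota 1 m).

Lemma msizeE mL : msize mL = sm m (fun u => mL u != 0).
Proof. by rewrite sm_count. Qed.

Lemma msize_le mL : msize mL <= m.
Proof. by rewrite /msize -[leqRHS](size_iota 1 m); exact: count_size. Qed.

Section Auction.
Context (T : nat).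

(* Invariant of the auction: [pr] are prices, [d u] is a lower bound on the prices of the neighbours of [u], slots before [ptr u] are known to exceed it. [u] is the current bidder (0 = none), left vertices above [s] have not bid yet. *)
Record auction (u s : nat) (mL mR d ptr pr : nat -> nat) : Prop := Auction {
  a_match : matching 0 mL mR;
  a_us : u <= s;
  a_sm : s <= m;
  a_d : forall y, 0 < y <= m -> d y <= T;
  a_p : forall y, 0 < y <= m -> ptr y <= D;
  a_pr : forall x, 0 < x <= m -> pr x <= T;
  a_arc : forall y j, 0 < y <= m -> j < D -> nb (y * D + j) <> 0 ->
    d y <= pr (nb (y * D + j));
  a_ptr : forall y j, 0 < y <= m -> j < ptr y -> nb (y * D + j) <> 0 ->
    d y < pr (nb (y * D + j));
  a_mate : forall y, 0 < y <= m -> mL y <> 0 -> pr (mL y) = (d y).+1;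
  a_free : forall x, 0 < x <= m -> pr x <> 0 -> mR x <> 0;
  a_idle : forall y, 0 < y <= m -> mL y = 0 -> [\/ y = u, s < y | d y = T];
  a_cur : u <> 0 -> mL u = 0 /\ d u < T;
  a_fresh : forall y, s < y <= m -> d y = 0 /\ mL y = 0
}.

Lemma auction_init mL mR d ptr pr :
  mL =1 (fun=> 0) -> mR =1 (fun=> 0) -> d =1 (fun=> 0) -> ptr =1 (fun=> 0) ->
  pr =1 (fun=> 0) -> auction 0 0 mL mR d ptr pr.
Proof.
move=> HL HR Hd Hp Hr; split=> //; try by move=> *; rewrite ?HL ?Hd ?Hp ?Hr.
- by split=> [u _|x _ _]; rewrite ?HL ?HR.
- by move=> y j _; rewrite Hp.
- by move=> y Hy _; constructor 2; lia.
Qed.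

Lemma auction_next s mL mR d ptr pr : 0 < T -> s < m ->
  auction 0 s mL mR d ptr pr -> auction s.+1 s.+1 mL mR d ptr pr.
Proof.
move=> HT Hs [h1 h2 h3 h4 h5 h6 h7 h8 h9 h10 h11 h12 h13]; split=> //.
- move=> y Hy /(h11 _ Hy) [E|H|->]; [lia| |by constructor 3].
  by have [->|/eqP E] := eqVneq y s.+1; [constructor 1|constructor 2; lia].
- by move=> _; have [|-> ->] := h13 s.+1; first lia.
- by move=> y Hy; apply: h13; lia.
Qed.

(** All slots have been scanned, so by [a_ptr] every neighbour of [u] costs more than [d u] and the
    lower bound may rise. A bidder whose bound reaches [T] retires. *)
Lemma auction_raise u s mL mR d ptr pr : u <> 0 -> ptr u = D ->
  auction u s mL mR d ptr pr ->
  auction (if (d u).+1 == T then 0 else u) s mL mR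
    (upd d u (d u).+1) (upd ptr u 0) pr.
Proof.
move=> Hu Hp [h1 h2 h3 h4 h5 h6 h7 h8 h9 h10 h11 h12 h13].
have [c1 c2] := h12 Hu.
have Hum : 0 < u <= m by lia.
split=> //.
- by case: ifP => //; lia.
- by move=> y Hy; rewrite updE; case: eqP => // _; exact: h4.
- by move=> y Hy; rewrite updE; case: eqP => // _; exact: h5.
- move=> y j Hy Hj Hn; rewrite updE; case: eqP => [E|_]; last exact: h7.
  by subst y; apply: h8 => //; lia.
- by move=> y j Hy; rewrite !updE; case: eqP => // _; exact: h8.
- move=> y Hy Hm; rewrite updE; case: eqP => [E|_]; last exact: h9.
  by subst y; rewrite c1 in Hm.
- move=> y Hy /(h11 _ Hy)[->|H|H].
  + case: eqP => E; last by constructor 1.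
    by constructor 3; rewrite upd_same.
  + by constructor 2.
  + constructor 3; rewrite updE; case: eqP => // E; subst y; lia.
- case: eqP => // E _; rewrite upd_same c1; lia.
- move=> y Hy; rewrite updE; case: eqP => [E|_]; [lia|exact: h13].
Qed.

Lemma auction_skip u s mL mR d ptr pr : u <> 0 -> ptr u < D ->
  (nb (u * D + ptr u) <> 0 -> pr (nb (u * D + ptr u)) <> d u) ->
  auction u s mL mR d ptr pr ->
  auction u s mL mR d (upd ptr u (ptr u).+1) pr.
Proof.
move=> Hu Hp Hn [h1 h2 h3 h4 h5 h6 h7 h8 h9 h10 h11 h12 h13].
have Hum : 0 < u <= m by lia.
split=> //.
- by move=> y Hy; rewrite updE; case: eqP => // _; exact: h5.
- move=> y j Hy; rewrite !updE; case: eqP => [E|_]; last exact: h8.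
  subst y => Hj Hnb; have [Ej|/eqP Ej] := eqVneq j (ptr u).
    by subst j; have := h7 u _ Hum Hp Hnb; have := Hn Hnb; lia.
  by apply: h8 => //; lia.
Qed.

(** The evicted mate becomes the bidder; its bound is one below the old price of [x], which is
    [d u < T], so it is still entitled to bid. If [x] was free, [mR x = 0] encodes that nobody bids,
    and the write to [mL 0] is harmless. *)
Lemma auction_bid u s x mL mR d ptr pr : u <> 0 -> ptr u < D ->
  nb (u * D + ptr u) = x -> x <> 0 -> pr x = d u ->
  auction u s mL mR d ptr pr ->
  auction (mR x) s (upd (upd mL (mR x) 0) u x) (upd mR x u) d ptr
    (upd pr x (pr x).+1).
Proof.
move=> Hu Hp Hx Hx0 Hpr [h1 h2 h3 h4 h5 h6 h7 h8 h9 h10 h11 h12 h13].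
have Hum : 0 < u <= m by lia.
have Hxm : 0 < x <= m by have := nb_le Hum Hp; lia.
have [c1 c2] := h12 Hu.
have Ho : mR x <> 0 -> 0 < mR x <= m /\ mL (mR x) = x by apply: matchR h1 _ _ _.
have Hou : mR x <> u by move=> E; case: (Ho); [lia|rewrite E c1 => _ E'; lia].
have Hpr' y : pr y <= upd pr x (pr x).+1 y by rewrite updE; case: eqP => [->|].
have HmL y : 0 < y <= m -> mL y = x -> y = mR x.
  by move=> Hy E; case: (matchL h1 Hy); rewrite E.
split=> //.
- split=> [y Hy|y Hy _].
  + rewrite updE; case: (y =P u) => [->|Hyu] => [_|].
      by split=> //; [split=> //; exists (ptr u)|rewrite upd_same].
    rewrite updE; case: eqP => // Hyo Hy0.
    case: (matchL h1 Hy Hy0) => p1 p2 p3; split=> //.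
    by rewrite upd_other // => E; case: Hyo; exact: HmL.
  + rewrite updE; case: (y =P x) => [->|Hyx] => [_|].
      by rewrite upd_same.
    move=> Hy0; case: (matchR h1 Hy _ Hy0) => [|p1 p2]; first lia.
    have n1 : mR y <> u by move=> E; rewrite E c1 in p2; lia.
    have n2 : mR y <> mR x.
      by move=> E; case: Ho => [|_ E']; [lia|case: Hyx; rewrite -p2 E].
    by rewrite !upd_other.
- case: (mR x =P 0) => [->//|/Ho[p1 p2]].
  rewrite leqNgt; apply/negP => Hs; case: (h13 (mR x)); first by lia.
  by rewrite p2.
- move=> y Hy; rewrite updE; case: eqP => // _; [lia|exact: h6].
- by move=> y j Hy Hj Hn; apply: leq_trans (Hpr' _); exact: h7.
- by move=> y j Hy Hj Hn; apply: leq_trans (Hpr' _); exact: h8.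
- move=> y Hy; rewrite updE; case: (y =P u) => [->|Hyu].
    by rewrite upd_same Hpr.
  rewrite updE; case: eqP => // Hyo Hy0.
  by rewrite upd_other ?h9 // => E; case: Hyo; exact: HmL.
- by move=> y Hy; rewrite !updE; case: eqP => _; [lia|exact: h10].
- move=> y Hy; rewrite updE; case: (y =P u) => [->|Hyu]; first by lia.
  rewrite updE; case: eqP => [->|Hyo]; first by constructor 1.
  by case/(h11 _ Hy) => // H; [constructor 2|constructor 3].
- move=> Hm0; case: (Ho Hm0) => p1 p2; rewrite upd_other // upd_same; split=> //.
  by have := h9 _ p1; rewrite p2 Hpr => /(_ Hx0); lia.
- move=> y Hy; rewrite !updE; case: eqP => [E|_]; first by lia.
  by case: (h13 y Hy) => -> ->; case: ifP.
Qed.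

(* Every level [j] in 1..T yields a cover, the left vertices with [d u < j] together with the right vertices with [pr x >= j]; it exceeds the matching by the number of right vertices of price exactly [j], so the excesses of all T covers add up to at most [m]. *)
Lemma auction_near_optimal mL mR d ptr pr mL' mR' :
  auction 0 m mL mR d ptr pr -> matching 0 mL' mR' ->
  T * msize mL' <= T * msize mL + m.
Proof.
move=> [h1 h2 h3 h4 h5 h6 h7 h8 h9 h10 h11 h12 h13] M'.
have cover j : 0 < j <= T ->
    msize mL' <= msize mL + sm m (fun x => pr x == j).
  move=> Hj.
  (* Level [j] covers each arc of the other matching: if the left end has [d >= j], then by [a_arc]
     the right end has price at least [j]. *)
  have l1 : msize mL' <= sm m (fun u => d u < j) + sm m (fun x => j <= pr x).
    rewrite msizeE.
    apply: (@leq_trans (sm m (fun u => d u < j) +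
                        sm m (fun u => (mL' u != 0) && (j <= d u)))).
      rewrite -sm_add; apply: sm_le => i _.
      by case: eqP => _ /=; lia.
    rewrite leq_add2l !sm_count; apply: (count_inj (f := mL')).
      move=> u Hu /andP[/eqP u0 Hju]; case: (matchL M' Hu u0) => Ha _ _.
      split; first exact: arc_range Ha.
      by case: Ha => x0 [k Hk Ek]; rewrite -Ek in x0 *; apply: leq_trans (h7 _ _ _ _ _).
    move=> u v Hu Hv /andP[/eqP u0 _] /andP[/eqP v0 _] E.
    have [_ Eu _] := matchL M' Hu u0; have [_ Ev _] := matchL M' Hv v0.
    by rewrite -Eu E Ev.
  (* A left vertex with [d u < j] has not retired, so it is matched, and its mate has price
     [d u + 1 <= j]. *)
  have l2 : sm m (fun u => d u < j) <=
      sm m (fun x => [&& mR x != 0, 0 < pr x & pr x <= j]).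
    rewrite !sm_count; have mat u : 0 < u <= m -> d u < j -> mL u <> 0.
      by move=> Hu Hd u0; case: (h11 u Hu u0); lia.
    apply: (count_inj (f := mL)) => [u Hu Hd|u v Hu Hv Hdu Hdv E].
      have u0 := mat u Hu Hd; case: (matchL h1 Hu u0) => Ha Hm _.
      split; first exact: arc_range Ha.
      rewrite Hm (h9 _ Hu u0); lia.
    have [_ Eu _] := matchL h1 Hu (mat u Hu Hdu).
    have [_ Ev _] := matchL h1 Hv (mat v Hv Hdv).
    by rewrite -Eu E Ev.
  have l3 : sm m (fun x => mR x != 0) <= msize mL.
    rewrite msizeE !sm_count; apply: (count_inj (f := mR)).
      by move=> x Hx /eqP x0; case: (matchR h1 Hx _ x0) => [|-> ->]; lia.
    move=> x y Hx Hy /eqP x0 /eqP y0 E.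
    have [|_ Ex] := matchR h1 Hx _ x0; first lia.
    have [|_ Ey] := matchR h1 Hy _ y0; first lia.
    by rewrite -Ex E Ey.
  (* Per right vertex, the price ranges 1..j and at least [j] overlap only at price [j], and a
     vertex of nonzero price is matched by [a_free]. *)
  apply: leq_trans l1 _; apply: leq_trans (leq_add l2 (leqnn _)) _.
  apply: leq_trans (leq_add l3 (leqnn _)).
  rewrite -!sm_add; apply: sm_le => i Hi.
  have := h10 i Hi; case: eqP => /= [-> H|_ _].
    by case: (pr i =P 0) => [->|/H]; lia.
  lia.
have sumT F c1 c2 n : n <= T -> (forall j, 0 < j <= T -> c1 <= c2 + F j) ->
    n * c1 <= n * c2 + sm n F.
  move=> + H; elim: n => // n IH Hn.
  rewrite /sm big_nat_recr //= -/(sm n F).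
  by have := IH (ltnW Hn); have := H n.+1; lia.
apply: leq_trans (sumT _ _ _ T (leqnn T) cover) _; rewrite leq_add2l.
rewrite /sm exchange_big /= -/(sm m _); apply: leq_trans (_ : sm m (fun=> 1) <= _).
  apply: sm_le => x _; rewrite -/(sm T _) sm_count.
  rewrite (@eq_count _ _ (pred1 (pr x))); last by move=> j; rewrite /= eq_sym.
  by rewrite count_uniq_mem ?iota_uniq //; exact: leq_b1.
by rewrite sm_const muln1.
Qed.

(** Potential of the auction. The weight [D.+1] makes a raise of [d u], which resets the pointer
    from [D] to 0, count exactly one, like a skip, a bid and a new bidder. *)
Definition work (s : nat) (d ptr pr : nat -> nat) : nat :=
  sm m (fun y => d y * D.+1 + ptr y) + sm m pr + s.

Lemma work_bound u s mL mR d ptr pr : auction u s mL mR d ptr pr ->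
  work s d ptr pr <= m * (T * D.+1 + D) + m * T + m.
Proof.
move=> A; rewrite /work -!(sm_const m); apply: leq_add; last exact: a_sm A.
apply: leq_add; apply: sm_le => y Hy; last exact: a_pr A _ Hy.
apply: leq_add; last exact: a_p A _ Hy.
by rewrite leq_mul2r (a_d A Hy) orbT.
Qed.

Lemma work_raise u s d ptr pr : 0 < u <= m -> ptr u = D ->
  work s (upd d u (d u).+1) (upd ptr u 0) pr = (work s d ptr pr).+1.
Proof.
move=> Hu Hp; rewrite /work.
have := @sm_upd m (fun y => upd d u (d u).+1 y * D.+1 + upd ptr u 0 y)
  (fun y => d y * D.+1 + ptr y) u Hu.
rewrite !upd_same Hp mulSn => H.
suff : sm m (fun y => upd d u (d u).+1 y * D.+1 + upd ptr u 0 y) =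
       (sm m (fun y => d y * D.+1 + ptr y)).+1 by lia.
suff /H : forall i, i <> u -> upd d u (d u).+1 i * D.+1 + upd ptr u 0 i = d i * D.+1 + ptr i by lia.
by move=> i Hi; rewrite !upd_other.
Qed.

Lemma work_skip u s d ptr pr : 0 < u <= m ->
  work s d (upd ptr u (ptr u).+1) pr = (work s d ptr pr).+1.
Proof.
move=> Hu; rewrite /work.
have := @sm_upd m (fun y => d y * D.+1 + upd ptr u (ptr u).+1 y)
  (fun y => d y * D.+1 + ptr y) u Hu.
rewrite !upd_same => H.
suff /H : forall i, i <> u ->
    d i * D.+1 + upd ptr u (ptr u).+1 i = d i * D.+1 + ptr i by lia.
by move=> i Hi; rewrite !upd_other.
Qed.

Lemma work_bid x s d ptr pr : 0 < x <= m ->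
  work s d ptr (upd pr x (pr x).+1) = (work s d ptr pr).+1.
Proof.
move=> Hx; rewrite /work.
have := @sm_upd m (upd pr x (pr x).+1) pr x Hx.
rewrite !upd_same => H.
suff /H : forall i, i <> x -> upd pr x (pr x).+1 i = pr i by lia.
by move=> i Hi; rewrite !upd_other.
Qed.

End Auction.
End Matching.

(** * Augmenting paths *)

Section Search.
Context (nb : nat -> nat) (D m : nat).
Context (nb_le : forall u j, 0 < u <= m -> j < D -> nb (u * D + j) <= m).

Record roots (i qt : nat) (mL Q par : nat -> nat) : Prop := Roots {
  r_qt : qt <= i;
  r_im : i <= m;
  r_par : forall x, 0 < x <= i -> par x = 0;
  r_Q : forall k, k < qt -> 0 < Q k <= m /\ mL (Q k) = 0;
  r_all : forall u, 0 < u <= i -> mL u = 0 -> exists2 k, k < qt & Q k = u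
}.

Lemma roots_free i qt mL Q par : i < m -> mL i.+1 = 0 -> roots i qt mL Q par ->
  roots i.+1 qt.+1 mL (upd Q qt i.+1) (upd par i.+1 0).
Proof.
move=> Hi H0 [h1 h2 h3 h4 h5]; split=> //.
- move=> x Hx; rewrite updE; case: eqP => // Hxi; apply: h3; lia.
- move=> k Hk; rewrite updE; case: eqP => [_|Hkq]; first by split=> //; lia.
  by apply: h4; lia.
- move=> u Hu Hu0; have [->|/eqP E] := eqVneq u i.+1.
    by exists qt => //; rewrite upd_same.
  have [|k Hk <-] := h5 u _ Hu0; first by lia.
  by exists k; [lia|rewrite upd_other //; lia].
Qed.

Lemma roots_matched i qt mL Q par : i < m -> mL i.+1 <> 0 -> roots i qt mL Q par ->
  roots i.+1 qt mL Q (upd par i.+1 0).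
Proof.
move=> Hi H0 [h1 h2 h3 h4 h5]; split=> //.
- by lia.
- move=> x Hx; rewrite updE; case: eqP => // Hxi; apply: h3; lia.
- move=> u Hu Hu0; apply: h5 => //; have : u <> i.+1 by congruence.
  by lia.
Qed.

(* Invariant of the breadth-first search. [Q] lists the reached left vertices; for a reached right vertex [x], [par x] is one plus the position in [Q] of its parent (0 = unreached). *)
Record search (qh qt j found : nat) (mL mR Q par : nat -> nat) : Prop := Search {
  s_match : matching nb D m 0 mL mR;
  s_q : qh <= qt;
  s_j : j <= D;
  s_qt : qt <= m + sm m (fun x => par x != 0);
  s_tree : forall i, i < qt -> 0 < Q i <= m /\
    (mL (Q i) <> 0 -> 0 < par (mL (Q i)) <= i);
  s_par : forall x, 0 < x <= m -> par x <> 0 ->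
    par x <= qt /\ arc nb D (Q (par x).-1) x;
  s_vis : found = 0 -> forall x, 0 < x <= m -> par x <> 0 ->
    mR x <> 0 /\ exists2 i, i < qt & Q i = mR x;
  s_found : found <> 0 -> [/\ 0 < found <= m, par found <> 0 & mR found = 0];
  s_roots : forall u, 0 < u <= m -> mL u = 0 -> exists2 i, i < qt & Q i = u;
  s_done : forall i k, i < qh -> k < D -> nb (Q i * D + k) <> 0 ->
    par (nb (Q i * D + k)) <> 0;
  s_cur : forall k, k < j -> nb (Q qh * D + k) <> 0 -> par (nb (Q qh * D + k)) <> 0
}.

Lemma search_init qt mL mR Q par : matching nb D m 0 mL mR ->
  roots m qt mL Q par -> search 0 qt 0 0 mL mR Q par.
Proof.
move=> M [h1 h2 h3 h4 h5]; split=> //.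
- by lia.
- by move=> i /h4 [p1 p2]; split=> //; lia.
- by move=> x Hx; rewrite h3.
- by move=> _ x Hx; rewrite h3.
Qed.

Lemma search_pop qh qt found mL mR Q par : qh < qt ->
  search qh qt D found mL mR Q par -> search qh.+1 qt 0 found mL mR Q par.
Proof.
move=> Hq [h1 h2 h3 h4 h5 h6 h7 h8 h9 h10 h11]; split=> // i k Hi Hk.
have [->|/eqP E] := eqVneq i qh; first exact: h11.
by apply: h10 => //; lia.
Qed.

Lemma search_skip qh qt j found mL mR Q par : j < D ->
  (nb (Q qh * D + j) <> 0 -> par (nb (Q qh * D + j)) <> 0) ->
  search qh qt j found mL mR Q par -> search qh qt j.+1 found mL mR Q par.
Proof.
move=> Hj Hn [h1 h2 h3 h4 h5 h6 h7 h8 h9 h10 h11]; split=> // k Hk.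
have [->|/eqP E] := eqVneq k j; first exact: Hn.
by apply: h11; lia.
Qed.

Lemma search_visit qh qt j x found mL mR Q par : qh < qt -> j < D ->
  nb (Q qh * D + j) = x -> x <> 0 -> par x = 0 -> found = 0 ->
  search qh qt j found mL mR Q par ->
  if mR x == 0 then search qh qt j.+1 x mL mR Q (upd par x qh.+1)
  else search qh qt.+1 j.+1 0 mL mR (upd Q qt (mR x)) (upd par x qh.+1).
Proof.
move=> Hq Hj Hx x0 Hp Hf [h1 h2 h3 h4 h5 h6 h7 h8 h9 h10 h11].
have {}h7 := h7 Hf.
have [Qm _] := h5 qh Hq.
have Hxm : 0 < x <= m by have := nb_le Qm Hj; lia.
have Hpar y : par y <> 0 -> upd par x qh.+1 y <> 0 by rewrite updE; case: eqP.
have Hsum : sm m (fun y => upd par x qh.+1 y != 0) = (sm m (fun y => par y != 0)).+1.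
  have := @sm_upd m (fun y => upd par x qh.+1 y != 0) (fun y => par y != 0) x Hxm.
  by rewrite upd_same Hp /= addn0 addn1 => -> // i Hi; rewrite upd_other.
have Hcur k : k < j.+1 -> nb (Q qh * D + k) <> 0 -> upd par x qh.+1 (nb (Q qh * D + k)) <> 0.
  have [->|/eqP E] := eqVneq k j; first by rewrite Hx upd_same.
  by move=> Hk Hn; apply: Hpar; apply: h11 => //; lia.
(* The mate of a queued matched vertex is already reached, so it differs from the unreached [x]. *)
have Htree i : i < qt -> 0 < Q i <= m /\
    (mL (Q i) <> 0 -> 0 < upd par x qh.+1 (mL (Q i)) <= i).
  move=> /h5 [p1 p2]; split=> // /p2 p3; rewrite upd_other // => E.
  by rewrite E Hp in p3.
have HQ i y : i < qt -> upd Q qt y i = Q i by move=> Hi; rewrite upd_other //; lia.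
case: eqP => Hm; split=> //; try by lia.
- move=> y Hy; rewrite updE; case: eqP => [-> _|_ /(h6 y Hy)//].
  by split; [lia|split=> //; exists j].
- by rewrite upd_same.
- by move=> i k Hi Hk Hn; apply: Hpar; exact: h10.
- move=> i; rewrite ltnS leq_eqVlt => /orP[/eqP->|Hi]; last by rewrite HQ //; exact: Htree.
  rewrite upd_same; case: (matchR h1 Hxm x0 Hm) => p1 p2; split=> //.
  by rewrite p2 upd_same => _; lia.
- move=> y Hy; rewrite updE; case: eqP => [-> _|_ Hy0].
    by rewrite HQ //; split; [lia|split=> //; exists j].
  by case: (h6 y Hy Hy0) => p1 p2; split; [lia|rewrite HQ //; lia].
- move=> _ y Hy; rewrite updE; case: eqP => [-> _|_ Hy0].
    by split=> //; exists qt => //; rewrite upd_same.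
  by case: (h7 y Hy Hy0) => p1 [i Hi Ei]; split=> //; exists i; [lia|rewrite HQ].
- by move=> u Hu /(h9 u Hu)[i Hi Ei]; exists i; [lia|rewrite HQ].
- by move=> i k Hi Hk; rewrite HQ; [move=> Hn; apply: Hpar; exact: h10|lia].
- by move=> k; rewrite HQ //; exact: Hcur.
Qed.

(** The entries of the queue need not be shown distinct: [s_qt] allows [m] of them for the roots and
    one for each reached right vertex. *)
Lemma search_bound qh qt j found mL mR Q par :
  search qh qt j found mL mR Q par -> qt <= 2 * m.
Proof.
move=> S; apply: leq_trans (s_qt S) _; rewrite mul2n -addnn leq_add2l.
by rewrite sm_count -[leqRHS](size_iota 1 m); exact: count_size.
Qed.

Definition pick (mL par : nat -> nat) (u : nat) : nat :=
  if par (mL u) == 0 then u else mL u.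

(* Koenig's theorem: choosing in every matching arc its right end if it is reached, and its left end otherwise, yields a cover. *)
Lemma search_cover qt j mL mR Q par u x :
  search qt qt j 0 mL mR Q par -> 0 < u <= m -> arc nb D u x ->
  exists y, [/\ 0 < y <= m, mL y <> 0 & pick mL par y = u \/ pick mL par y = x].
Proof.
move=> [h1 h2 h3 h4 h5 h6 h7 h8 h9 h10 h11] Hu Ha.
have Hx := arc_range nb_le Hu Ha.
have [Hp|/eqP Hp] := eqVneq (par x) 0; last first.
  case: (h7 erefl x Hx Hp) => p1 _; case: (matchR h1 Hx _ p1) => [|p2 p3]; first lia.
  exists (mR x); split=> //; first by rewrite p3; lia.
  by right; rewrite /pick p3 (introF eqP Hp).
(* Head and tail coincide, so every queued vertex has been scanned and all its neighbours are
   reached. *)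
have Hu' i : i < qt -> Q i = u -> par x <> 0.
  move=> Hi E; case: Ha => x0 [k Hk Ek]; subst u x.
  exact: h10.
have u0 : mL u <> 0 by move=> E; case: (h9 u Hu E) => i Hi /(Hu' i Hi).
(* If the mate of [u] were reached, then [u] would be queued and [x] reached. *)
exists u; split=> //; left; rewrite /pick; case: eqP => // Hpu.
have [Hau Hmu _] := matchL h1 Hu u0.
case: (h7 erefl _ (arc_range nb_le Hu Hau) Hpu) => _ [i Hi].
by rewrite Hmu => /(Hu' i Hi).
Qed.

(** State while the path is flipped from its free right end towards its root. [v] is the right
    vertex still to be matched and is counted in advance by [f_size]; [f_tree] retains only the
    queue positions before [par v], where the search tree is still intact. *)
Record flip (v c : nat) (mL mR Q par : nat -> nat) : Prop := Flip {
  f_match : matching nb D m v mL mR;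
  f_v : v <= m;
  f_par : forall x, 0 < x <= m -> par x <> 0 -> arc nb D (Q (par x).-1) x;
  f_v0 : v <> 0 -> par v <> 0;
  f_tree : v <> 0 -> forall i, i < par v -> 0 < Q i <= m /\
    (mL (Q i) <> 0 -> 0 < par (mL (Q i)) <= i);
  f_size : msize m mL + (v != 0) = c
}.

Lemma flip_init qh qt j found mL mR Q par : found <> 0 ->
  search qh qt j found mL mR Q par -> flip found (msize m mL).+1 mL mR Q par.
Proof.
move=> Hf [h1 h2 h3 h4 h5 h6 h7 h8 h9 h10 h11].
case: (h8 Hf) => f1 f2 f3; split=> //; first split.
- move=> u Hu u0; case: (matchL h1 Hu u0) => p1 p2 _; split=> // E.
  by have := p2; rewrite E f3; lia.
- by move=> x Hx _; apply: (matchR h1 Hx); lia.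
- by lia.
- by move=> x Hx Hp; case: (h6 x Hx Hp).
- by move=> _ i Hi; apply: h5; apply: leq_trans Hi _; case: (h6 _ f1 f2).
- by rewrite (introF eqP Hf) addn1.
Qed.

(** The parent [u] of [v] moves from its old mate [w] to [v], and [w] is the next hole. Its parent
    lies strictly earlier in the queue, so the walk ends, namely at a root, where [w = 0]. *)
Lemma flip_step v c mL mR Q par (u := Q (par v).-1) (w := mL u) : v <> 0 ->
  flip v c mL mR Q par ->
  flip w c (upd mL u v) (upd mR v u) Q par /\ (w <> 0 -> par w < par v).
Proof.
move=> v0 [h1 h2 h3 h4 h5 h6].
have {}h4 := h4 v0; have {}h5 := h5 v0.
have Hv : 0 < v <= m by lia.
have [|Hu Ht] := h5 (par v).-1; first by lia.
have Hpw : w <> 0 -> par w < par v by move/Ht; rewrite -/u -/w; lia.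
have Ha : arc nb D u v by exact: h3.
have Hw : w <> 0 -> [/\ 0 < w <= m, mR w = u & w <> v].
  move=> w0; case: (matchL h1 Hu w0) => p1 p2 p3; split=> //.
  exact: arc_range p1.
split=> //; split.
- split.
  + move=> y Hy; rewrite updE; case: eqP => [->|Hyu].
      by move=> _; rewrite upd_same; split=> // E; have [] := Hw _; lia.
    move=> y0; case: (matchL h1 Hy y0) => p1 p2 p3; split=> //.
      by rewrite upd_other.
    by move=> E; case: Hw => [|_]; [lia|rewrite -E p2].
  + move=> x Hx Hxw; rewrite updE; case: eqP => [->|Hxv].
      by move=> _; rewrite upd_same.
    move=> x0; case: (matchR h1 Hx Hxv x0) => p1 p2; split=> //.
    by rewrite upd_other // => E; case: Hxw; rewrite -p2 E.
- by have [->//|/eqP/Hw[]] := eqVneq w 0; lia.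
- exact: h3.
- by move/Ht => H; rewrite -/u -/w in H; lia.
- move=> w0 i Hi; have Hlt := Hpw w0.
  have [|Hq Hti] := h5 i; first lia.
  (* If [u] also stood at a position [i < par w], the tree condition would give [par w <= i]. *)
  split=> //; rewrite upd_other // => E.
  by have := Hti; rewrite E -/w => /(_ w0); lia.
- have := @sm_upd m (fun y => upd mL u v y != 0) (fun y => mL y != 0) u Hu.
  rewrite -!msizeE upd_same -/w (introF eqP v0) /= => H.
  rewrite -h6 (introF eqP v0) /= -H // => i Hi.
  by rewrite upd_other.
Qed.

End Search.

(** * Conflict graph *)

Lemma mix_inj n a b a' b' :
  b < n -> b' < n -> a * n + b = a' * n + b' -> a = a' /\ b = b'.
Proof.
move=> Hb Hb' E; have Hn : 0 < n by lia.
have : (a * n + b) %/ n = (a' * n + b') %/ n by rewrite E.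
by rewrite !divnMDl // !divn_small // !addn0 => Ea; split=> //; lia.
Qed.

Section Graph.
Context (n : nat) (E : seq edge) (k : nat) (wfE : wf_graph n E).
Notation m := (size E).

(* Edges are numbered from 1, so that 0 can stand for no edge. *)
Definition ed (e : nat) : edge := nth (0, 0, false) E e.-1.

Definition joins (e a b : nat) (c : bool) : Prop :=
  0 < e <= m /\ (ed e = (a, b, c) \/ ed e = (b, a, c)).

Lemma joinsC e a b c : joins e a b c -> joins e b a c.
Proof. by case=> He [] H; split; auto. Qed.

Lemma pred_lt e : 0 < e <= m -> e.-1 < m.
Proof. by case: e. Qed.

Lemma mem_ed e : 0 < e <= m -> ed e \in E.
Proof. by move=> He; apply: mem_nth; exact: pred_lt. Qed.

Lemma has_edgeP a b c : reflect (exists e, joins e a b c) (has_edge E a b c).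
Proof.
apply: (iffP orP) => [|[e [He H]]].
  move=> H; have : exists2 x, x \in E & x = (a, b, c) \/ x = (b, a, c).
    by case: H => H; [exists (a, b, c)|exists (b, a, c)]; auto.
  case=> x Hx Ex; exists (index x E).+1.
  by split; [rewrite /= index_mem|rewrite /ed /= nth_index].
by have := mem_ed He; case: H => ->; auto.
Qed.

Lemma has_edgeC a b c : has_edge E a b c = has_edge E b a c.
Proof. by rewrite /has_edge orbC. Qed.

Lemma is_edgeC a b : is_edge E a b = is_edge E b a.
Proof. by rewrite /is_edge !(has_edgeC a b). Qed.

Lemma is_edgeP a b : reflect (exists e c, joins e a b c) (is_edge E a b).
Proof.
apply: (iffP orP) => [[/has_edgeP[e H]|/has_edgeP[e H]]|[e [[] H]]].
- by exists e, false.
- by exists e, true.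
- by right; apply/has_edgeP; exists e.
- by left; apply/has_edgeP; exists e.
Qed.

Lemma joins_lt e a b c : joins e a b c -> [/\ a < n, b < n & a <> b].
Proof.
case=> He; have := allP (proj1 wfE) _ (mem_ed He).
by case: (ed e) => -[u v] d /and3P[? ? /eqP?] [] [<- <- _]; split=> //; congruence.
Qed.

Lemma joins_inj e e' a b c c' : joins e a b c -> joins e' a b c' -> e = e' /\ c = c'.
Proof.
move=> J J'; have : e = e'.
  case: J J' => He H [He' H'].
  set key := fun x : edge => let: (u, v, _) := x in (minn u v, maxn u v).
  have U : uniq (map key E) := proj2 wfE.
  suff : e.-1 = e'.-1 by lia.
  have s1 : e.-1 < size (map key E) by rewrite size_map; exact: pred_lt.
  have s2 : e'.-1 < size (map key E) by rewrite size_map; exact: pred_lt.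
  apply/eqP; rewrite -(nth_uniq (key (0, 0, false)) s1 s2 U).
  rewrite !(nth_map (0, 0, false)) ?pred_lt //.
  rewrite -/(ed e) -/(ed e').
  by case: H => ->; case: H' => -> /=; rewrite ?[minn b a]minnC ?[maxn b a]maxnC.
move=> Ee; split=> //; subst e'; case: J J' => _ + [_].
by case=> ->; case=> -[].
Qed.

Lemma E_uniq : uniq E.
Proof. exact: map_uniq (proj2 wfE). Qed.

Lemma ed_inj e e' : 0 < e <= m -> 0 < e' <= m -> ed e = ed e' -> e = e'.
Proof.
move=> He He' /eqP; rewrite /ed nth_uniq ?E_uniq ?pred_lt // => /eqP; lia.
Qed.

Definition conflict (e x : nat) : Prop := exists a b w,
  [/\ joins e a b false, joins x b w true, a <> w & ~~ is_edge E a w].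

Lemma conflict_range e x : conflict e x -> 0 < e <= m /\ 0 < x <= m.
Proof. by case=> a [b [w [[? _] [? _] _ _]]]. Qed.

Lemma edge_in_P3C x y : edge_in_P3 E x y -> edge_in_P3 E y x.
Proof.
case=> u [v [w [H H']]]; exists u, v, w; split=> //.
case: H' => -[-> ->]; [constructor 2|constructor 1|constructor 4|constructor 3]; split=> //.
Qed.

Lemma conflict_P3 e x a b w : joins e a b false -> joins x b w true ->
  a <> w -> ~~ is_edge E a w -> bicolored_P3 E a b w.
Proof.
move=> J1 J2 Haw Hn; have [_ _ n1] := joins_lt J1; have [_ _ n2] := joins_lt J2.
split=> //; try exact/eqP.
exists false, true; split=> //; apply/has_edgeP; first by exists e.
by exists x.
Qed.

Lemma conflict_in_P3 e x p q c : conflict e x -> joins e p q c \/ joins x p q c ->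
  edge_in_P3 E p q.
Proof.
case=> a [b [w [J1 J2 Haw Hn]]] H.
have P := conflict_P3 J1 J2 Haw Hn; exists a, b, w; split=> //.
case: H => -[_ H]; [case: J1 => _ J|case: J2 => _ J]; case: J H => -> [] [<- <- _].
- by constructor 1.
- by constructor 2.
- by constructor 2.
- by constructor 1.
- by constructor 3.
- by constructor 4.
- by constructor 4.
- by constructor 3.
Qed.

(** * Matchings and covers against deletion sets *)

Section Duality.
Context (mL pk : nat -> nat).
Context (mL_conflict : forall u, 0 < u <= m -> mL u <> 0 -> conflict u (mL u)).
Context (mL_inj : forall u v, 0 < u <= m -> 0 < v <= m ->
  mL u <> 0 -> mL u = mL v -> u = v).
Context (pk_end : forall u, pk u = u \/ pk u = mL u).
Context (pk_cover : forall e x, conflict e x ->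
  exists y, [/\ 0 < y <= m, mL y <> 0 & pk y = e \/ pk y = x]).

Let L := [seq u <- iota 1 m | mL u != 0].

Let mem_L u : (u \in L) = (mL u != 0) && (0 < u <= m).
Proof. by rewrite mem_filter mem_iota; congr (_ && _); lia. Qed.

(** A solution must contain an end of every conflict, and the conflicts of a matching are pairwise
    disjoint; [f] selects a deleted end of each. *)
Lemma matching_le_deletion : bp3d_yes E k -> msize m mL <= k.
Proof.
case=> S [SE SU Sk SF]; apply: leq_trans Sk.
rewrite /msize -size_filter -/L.
have hit e x : conflict e x -> ed e \in S \/ ed x \in S.
  case=> a [b [w [J1 J2 Haw Hn]]].
  case H1 : (ed e \in S); first by left.
  case H2 : (ed x \in S); first by right.
  have [_ _ n1] := joins_lt J1; have [_ _ n2] := joins_lt J2.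
  case: (SF a b w); split; try exact/eqP.
    exists false, true; split=> //.
      case: J1 => He J1; have := mem_ed He; rewrite /has_edge !mem_filter.
      by case: J1 H1 => -> ->; rewrite /= => ->; rewrite ?orbT.
    case: J2 => He J2; have := mem_ed He; rewrite /has_edge !mem_filter.
    by case: J2 H2 => -> ->; rewrite /= => ->; rewrite ?orbT.
  apply: contraNN Hn; rewrite /is_edge /has_edge !mem_filter.
  by case/orP=> /orP[] /andP[_ ->]; rewrite ?orbT.
pose f u := if ed u \in S then ed u else ed (mL u).
rewrite -(size_map f); apply: uniq_leq_size; last first.
  move=> x /mapP[u]; rewrite mem_L => /andP[/eqP u0 Hu] ->; rewrite /f.
  by case: ifP => // H; case: (hit _ _ (mL_conflict Hu u0)); rewrite ?H.
(* Left ends are red and right ends blue, so [f] cannot identify ends from opposite sides. *)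
have col u : 0 < u <= m -> mL u <> 0 -> (ed u).2 = false /\ (ed (mL u)).2 = true.
  move=> Hu /(mL_conflict Hu)[a [b [w [[_ J1] [_ J2] _ _]]]].
  by case: J1 => ->; case: J2 => ->.
rewrite map_inj_in_uniq ?filter_uniq ?iota_uniq // => u v.
rewrite !mem_L => /andP[/eqP u0 Hu] /andP[/eqP v0 Hv]; rewrite /f.
have [cu cu'] := col u Hu u0; have [cv cv'] := col v Hv v0.
have [_ ru] := conflict_range (mL_conflict Hu u0).
have [_ rv] := conflict_range (mL_conflict Hv v0).
case: ifP => _; case: ifP => _ Ef.
- exact: ed_inj Ef.
- by move: cu; rewrite Ef cv'.
- by move: cu'; rewrite Ef cv.
- by apply: mL_inj => //; exact: ed_inj Ef.
Qed.

Lemma deletion_of_cover : ~ has_endangered_K3 E -> msize m mL <= k -> bp3d_yes E k.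
Proof.
move=> Hend Hk.
pose S := undup [seq ed (pk u) | u <- L].
have memS x : x \in S -> exists u, [/\ 0 < u <= m, mL u <> 0 & x = ed (pk u)].
  rewrite mem_undup => /mapP[u]; rewrite mem_L => /andP[/eqP u0 Hu] ->.
  by exists u.
have pk_range u : 0 < u <= m -> mL u <> 0 -> 0 < pk u <= m.
  move=> Hu u0; have [_ ru] := conflict_range (mL_conflict Hu u0).
  by case: (pk_end u) => ->.
have hit e x : conflict e x -> ed e \in S \/ ed x \in S.
  move=> /pk_cover[y [Hy y0 H]].
  have : ed (pk y) \in S.
    by rewrite mem_undup; apply: map_f; rewrite mem_L Hy andbT; exact/eqP.
  by case: H => ->; auto.
have kept a b c : has_edge [seq e <- E | e \notin S] a b c ->
    exists2 e, joins e a b c & ed e \notin S.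
  rewrite /has_edge !mem_filter => H.
  have : exists x, [/\ x \in E, x \notin S & x = (a, b, c) \/ x = (b, a, c)].
    by case/orP: H => /andP[? ?]; [exists (a, b, c)|exists (b, a, c)]; split; auto.
  case=> x [Hx Hn Ex]; exists (index x E).+1.
    by split; [rewrite /= index_mem|rewrite /ed /= nth_index].
  by rewrite /ed /= nth_index.
exists S; split.
- by move=> x /memS[u [Hu u0 ->]]; apply: mem_ed; exact: pk_range.
- exact: undup_uniq.
- apply: leq_trans (size_undup _) _.
  by rewrite size_map size_filter.
move=> u v w [/eqP n1 /eqP n2 /eqP n3 [b1 [b2 [/kept[e J1 S1] /kept[x J2 S2] Hb]]] Hn].
(* If [uw] was no edge before the deletion, the surviving path is a conflict of [E], which [S] has
   hit. *)
have [Hw|Hw] := boolP (is_edge E u w); last first.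
  case: b1 J1 Hb => J1; case: b2 J2 => J2 // _.
    have Hc : conflict x e.
      exists w, v, u; split; [exact: joinsC|exact: joinsC|by auto|by rewrite is_edgeC].
    by case: (hit _ _ Hc) => H; [rewrite H in S2|rewrite H in S1].
  have Hc : conflict e x by exists u, v, w.
  by case: (hit _ _ Hc) => H; [rewrite H in S1|rewrite H in S2].
case/is_edgeP: Hw => f [c Jf].
have Sf : ed f \in S.
  apply: contraNT Hn => Hf; have := mem_ed (proj1 Jf).
  rewrite /is_edge /has_edge !mem_filter => Hin.
  by case: Jf => _ [] Ef; move: Hf Hin; rewrite Ef; case: (c) => -> ->; rewrite ?orbT.
(* This is where it matters that the cover consists of ends of matching arcs: every deleted edge
   lies on a bicolored P3 of the original graph. *)
have Pf : edge_in_P3 E u w.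
  have [y [Hy y0 Ey]] := memS _ Sf.
  have Ef : f = pk y by apply: ed_inj Ey => //; [case: Jf|exact: pk_range].
  apply: conflict_in_P3 (mL_conflict Hy y0) _.
  by move: Jf; rewrite Ef; case: (pk_end y) => -> J; [left|right]; exact: J.
case: Hend; have hJ e' p q d : joins e' p q d -> has_edge E p q d.
  by move=> J; apply/has_edgeP; exists e'.
(* The path uses both colours, so [uw] shares its colour with one of its edges. The vertex common to
   these two edges is the middle vertex of the endangered K3. *)
have Hc : c = b1 \/ c = b2 by case: (c) (b1) (b2) Hb => -[] [] //; auto.
case: Hc => Ec; subst c.
- exists w, u, v, b1; split; try by apply/eqP; auto.
    split; [exact: hJ (joinsC Jf)|exact: hJ J1|].
    have -> : ~~ b1 = b2 by case: (b1) (b2) Hb => -[].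
    exact: hJ (joinsC J2).
  by left; exact: edge_in_P3C.
- exists u, w, v, b2; split; try by apply/eqP; auto.
    split; [exact: hJ Jf|exact: hJ (joinsC J2)|].
    have -> : ~~ b2 = b1 by case: (b1) (b2) Hb => -[].
    exact: hJ J1.
  by left.
Qed.

End Duality.

(** * Input format, adjacency matrix and conflict table *)

Definition input := encode n E k.

(** Numbering the edges from 1 absorbs the three header cells: the triple of edge [e] starts at
    [3 * e]. *)
Lemma input_edge e : 0 < e <= m ->
  [/\ input (3 * e) = (ed e).1.1, input (3 * e + 1) = (ed e).1.2
    & input (3 * e + 2) = (ed e).2].
Proof.
move=> He; rewrite /input /encode /ed.
have F r : r < 3 -> [/\ 3 * e + r == 0 = false, 3 * e + r == 1 = false,
    3 * e + r == 2 = false, (3 * e + r - 3) %/ 3 = e.-1 & (3 * e + r - 3) %% 3 = r].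
  by move=> Hr; split; lia.
have Hlt : e.-1 < m by lia.
have [f1 f2 f3 f4 f5] := F 0 isT; rewrite addn0 in f1 f2 f3 f4 f5.
rewrite f1 f2 f3 f4 f5 Hlt.
have [g1 g2 g3 g4 g5] := F 1 isT; rewrite g1 g2 g3 g4 g5 Hlt.
have [h1 h2 h3 h4 h5] := F 2 isT; rewrite h1 h2 h3 h4 h5 Hlt.
by case: (nth _ _ _) => -[u v] c.
Qed.

Lemma ed_lt e : 0 < e <= m -> [/\ (ed e).1.1 < n & (ed e).1.2 < n].
Proof.
move=> He; have [] := @joins_lt e (ed e).1.1 (ed e).1.2 (ed e).2; last by [].
by split=> //; left; case: (ed e) => -[].
Qed.

Lemma input_le x : input x <= n + m + k + 1.
Proof.
rewrite /input /encode; case: eqP => _; first by lia.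
case: eqP => _; first by lia.
case: eqP => _; first by lia.
case: ltnP => // H.
have := @ed_lt ((x - 3) %/ 3).+1 H; rewrite /ed /=.
case: (nth _ _ _) => -[u v] c [/= Hu Hv].
do 2 (case: ifP => _; first by lia).
by case: c; lia.
Qed.

Record adj (i : nat) (A : nat -> nat) : Prop := Adj {
  adj_joins : forall a b, a < n -> b < n -> A (a * n + b) <> 0 ->
    A (a * n + b) <= i /\ exists c, joins (A (a * n + b)) a b c;
  adj_find : forall e a b c, e <= i -> joins e a b c -> A (a * n + b) = e
}.

(** Provided by the zero memory of the machine; a loop over all n^2 cells would be too slow for
    sparse graphs. *)
Lemma adj_init A : A =1 (fun=> 0) -> adj 0 A.
Proof.
move=> H; split=> [a b _ _|e a b c He [He' _]]; rewrite H //; lia.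
Qed.

(** No two edges join the same pair of vertices, so the two stores overwrite no earlier entry. *)
Lemma adj_step i A (u := (ed i.+1).1.1) (v := (ed i.+1).1.2) : i < m -> adj i A ->
  adj i.+1 (upd (upd A (u * n + v) i.+1) (v * n + u) i.+1).
Proof.
move=> Hi [h1 h2].
have J : joins i.+1 u v (ed i.+1).2.
  by split=> //; left; rewrite /u /v; case: (ed _) => -[].
have [Hu Hv Huv] := joins_lt J.
split=> [a b Ha Hb|e a b c He Je].
- rewrite !updE; case: eqP => [/(mix_inj Hb Hu)[-> ->] _|_].
    by split=> //; exists (ed i.+1).2; exact: joinsC.
  case: eqP => [/(mix_inj Hb Hv)[-> ->] _|_].
    by split=> //; exists (ed i.+1).2.
  by case/(h1 a b Ha Hb) => p1 p2; split=> //; exact: leqW.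
- have [Ha Hb _] := joins_lt Je.
  rewrite !updE; case: eqP => [/(mix_inj Hb Hu)[Ea Eb]|n1].
    by rewrite Ea Eb in Je; have [] := joins_inj (joinsC J) Je.
  case: eqP => [/(mix_inj Hb Hv)[Ea Eb]|n2].
    by rewrite Ea Eb in Je; have [] := joins_inj J Je.
  apply: h2 (Je); suff : e <> i.+1 by lia.
  move=> Ee; rewrite Ee in Je; case: Je => _.
  by case=> Ei; rewrite /u /v Ei in n1 n2.
Qed.

Section Table.
Context (A : nat -> nat) (adjA : adj m A).

(** A conditional written as a product: the factors after the edge number test that [bw] is blue,
    that [e] is red and, by truncated subtraction, that [aw] is no edge. If [bw] is no edge, the
    colour lookup reads cell 2, which holds [k], but the first factor is then 0. *)
Definition entry (e a b w : nat) : nat :=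
  A (b * n + w) * input (3 * A (b * n + w) + 2) * (1 - input (3 * e + 2)) * (1 - A (a * n + w)).

Lemma entryP e a b w c x : joins e a b c -> w < n ->
  entry e a b w = x /\ x <> 0 <->
  [/\ c = false, joins x b w true & ~~ is_edge E a w].
Proof.
move=> J Hw; have [Ha Hb _] := joins_lt J.
have Hedge : (A (a * n + w) == 0) = ~~ is_edge E a w.
  apply/eqP/idP => [H|H].
    by apply/is_edgeP => -[f [d Jf]]; have := adj_find adjA (_ : f <= m) Jf;
       case: Jf => Hf _; rewrite H; lia.
  case: (A (a * n + w) =P 0) => // /(adj_joins adjA Ha Hw)[_ [d Jd]].
  by case/is_edgeP: H; exists (A (a * n + w)), d.
have [_ _ Hce] := input_edge (proj1 J).
have Ece : (ed e).2 = c by case: J => _ [] ->.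
rewrite /entry Hce Ece; split=> [[Ex x0]|[-> Jx Hn]].
- have y0 : A (b * n + w) <> 0 by move=> H; rewrite H in Ex; lia.
  have [Hy [d Jd]] := adj_joins adjA Hb Hw y0.
  have [_ _ Hcy] := input_edge (proj1 Jd).
  have Ecy : (ed (A (b * n + w))).2 = d by case: Jd => _ [] ->.
  rewrite Hcy Ecy in Ex; rewrite -Hedge.
  case: c {J Hce Ece} Ex => /= Ex; first by lia.
  case: d Jd Hcy Ecy Ex => Jd Hcy Ecy /= Ex; last by lia.
  have : A (a * n + w) = 0 by nia.
  move=> Ha0; rewrite Ha0 in Ex *.
  by have <- : A (b * n + w) = x by lia.
- have Hx := proj1 Jx.
  have Ey : A (b * n + w) = x by apply: (adj_find adjA _ Jx); lia.
  have [_ _ Hcx] := input_edge Hx.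
  have Ecx : (ed x).2 = true by case: Jx => _ [] ->.
  have Ha0 : A (a * n + w) = 0 by apply/eqP; rewrite Hedge.
  by rewrite Ey Ha0 Hcx Ecx; split; lia.
Qed.

Lemma entry_le e w s : 0 < e <= m -> w < n ->
  entry e (if s then (ed e).1.2 else (ed e).1.1) (if s then (ed e).1.1 else (ed e).1.2) w <= m.
Proof.
move=> He Hw; set a := (X in entry _ X); set b := (X in entry _ _ X).
have J : joins e a b (ed e).2.
  by rewrite /a /b; split=> //; case: (s); [right|left]; case: (ed e) => -[].
case: (entry e a b w =P 0) => [->//|H].
by case: (proj1 (entryP (entry e a b w) J Hw) (conj erefl H)) => _ [] /andP[].
Qed.

(** A single counter [p] runs through the pairs of an edge and a vertex [w] row by row, replacing
    nested loops. Slots [2 * w] and [2 * w + 1] belong to the two choices of the endpoint of [e] in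
    the middle of the path. *)
Definition filled (p : nat) (nb : nat -> nat) : Prop :=
  forall e w, 0 < e <= m -> w < n -> e.-1 * n + w < p ->
    nb (e * (2 * n) + 2 * w) = entry e (ed e).1.1 (ed e).1.2 w /\
    nb (e * (2 * n) + 2 * w + 1) = entry e (ed e).1.2 (ed e).1.1 w.

Lemma filled_step p nb (e := (p %/ n).+1) (w := p - p %/ n * n) :
  p < m * n -> filled p nb ->
  filled p.+1 (upd (upd nb (e * (2 * n) + 2 * w) (entry e (ed e).1.1 (ed e).1.2 w))
     (e * (2 * n) + 2 * w + 1) (entry e (ed e).1.2 (ed e).1.1 w)).
Proof.
move=> Hp H e' w' He' Hw' Hlt.
have Hn : 0 < n by lia.
have Ep : p = p %/ n * n + w by rewrite /w; have := leq_trunc_div p n; lia.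
have Hw : w < n by rewrite /w; have := ltn_ceil p Hn; rewrite mulSn; lia.
have [Ee|/eqP Ne] := eqVneq (e'.-1 * n + w') p.
  have [E1 E2] := mix_inj Hw' Hw (etrans Ee Ep).
  have -> : e' = e by rewrite /e; lia.
  rewrite E2 upd_same upd_other ?upd_same //; lia.
have [|H1 H2] := H e' w' He' Hw'; first by lia.
have N s s' : s < 2 -> s' < 2 -> e' * (2 * n) + 2 * w' + s <> e * (2 * n) + 2 * w + s'.
  move=> Hs Hs'; rewrite -(addnA _ _ s) -(addnA _ _ s') => Ei.
  have [||E1 E2] := mix_inj _ _ Ei; [lia|lia|].
  apply: Ne; rewrite E1 Ep; have -> : w' = w by lia.
  by rewrite /e.
have N00 := N 0 0 isT isT; have N01 := N 0 1 isT isT.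
have N10 := N 1 0 isT isT; have N11 := N 1 1 isT isT.
rewrite !addn0 in N00 N01 N10.
by rewrite !upd_other.
Qed.

Context (nb : nat -> nat) (nbF : filled (m * n) nb).

Lemma filled_entry e w s : 0 < e <= m -> w < n ->
  nb (e * (2 * n) + (2 * w + (s : bool))) =
  entry e (if s then (ed e).1.2 else (ed e).1.1) (if s then (ed e).1.1 else (ed e).1.2) w.
Proof.
move=> He Hw; have [|H1 H2] := nbF He Hw; first by nia.
by case: s => /=; rewrite addnA ?addn0.
Qed.

Lemma table_le e j : 0 < e <= m -> j < 2 * n -> nb (e * (2 * n) + j) <= m.
Proof.
move=> He Hj.
have -> : j = 2 * j./2 + odd j by rewrite mul2n addnC odd_double_half.
by rewrite filled_entry //; [apply: entry_le => //; lia|lia].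
Qed.

Lemma table_arc e x : 0 < e <= m -> arc nb (2 * n) e x <-> conflict e x.
Proof.
move=> He.
have J (s : bool) : joins e (if s then (ed e).1.2 else (ed e).1.1)
    (if s then (ed e).1.1 else (ed e).1.2) (ed e).2.
  by split=> //; case: s; [right|left]; case: (ed e) => -[].
split=> [[x0 [j Hj]]|[a [b [w [J1 J2 Haw Hn]]]]].
- have Hw : j./2 < n by lia.
  (* Half of the slot number is the third vertex; its parity is the orientation of [e]. *)
  have -> : j = 2 * j./2 + odd j by rewrite mul2n addnC odd_double_half.
  rewrite filled_entry // => Ex.
  have [Ec Jx Hn] := proj1 (entryP x (J (odd j)) Hw) (conj Ex x0).
  have J' := J (odd j); rewrite Ec in J'.
  do 3 eexists; split; [exact: J'|exact: Jx| |exact: Hn].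
  (* [entry] does not test [a <> w]: equality would make [e] and [x] one edge with two colours. *)
  by move=> Eaw; rewrite -Eaw in Jx; case: (joins_inj J' (joinsC Jx)).
- have [s [Ea Eb]] : exists s : bool,
      a = (if s then (ed e).1.2 else (ed e).1.1) /\ b = (if s then (ed e).1.1 else (ed e).1.2).
    by case: J1 => _ [] ->; [exists false|exists true].
  have [_ Hw _] := joins_lt J2.
  have [Ex x0] := proj2 (entryP x J1 Hw) (And3 erefl J2 Hn).
  split=> //; exists (2 * w + s); first by case: (s); lia.
  by rewrite filled_entry // -Ea -Eb.
Qed.

End Table.
End Graph.

(** * The program *)

(* Arrays: [aI] input copy, [aA] adjacency matrix with edge numbers as entries, [aN] conflict table with [2 n] slots per edge, [aL], [aR] the two sides of the matching, [ad], [ap], [apr] the labels, slot pointers and prices of the auction, [aQ], [apar] queue and parents of the search. *)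
Local Notation vAns := 0 (only parsing).
Local Notation vm := 1 (only parsing).
Local Notation vn := 2 (only parsing).
Local Notation vk := 3 (only parsing).
Local Notation vD := 4 (only parsing).
Local Notation vT := 5 (only parsing).
Local Notation vi := 6 (only parsing).
Local Notation vu := 7 (only parsing).
Local Notation vx := 8 (only parsing).
Local Notation vj := 9 (only parsing).
Local Notation vqh := 10 (only parsing).
Local Notation vqt := 11 (only parsing).
Local Notation vf := 12 (only parsing).
Local Notation vw := 13 (only parsing).
Local Notation vgo := 14 (only parsing).
Local Notation vs := 15 (only parsing).
Local Notation ve := 16 (only parsing).
Local Notation aI := 0 (only parsing).
Local Notation aA := 1 (only parsing).
Local Notation aN := 2 (only parsing).
Local Notation aL := 3 (only parsing).
Local Notation aR := 4 (only parsing).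
Local Notation ad := 5 (only parsing).
Local Notation ap := 6 (only parsing).
Local Notation apr := 7 (only parsing).
Local Notation aQ := 8 (only parsing).
Local Notation apar := 9 (only parsing).

Declare Scope code_scope.
Delimit Scope code_scope with code.
Bind Scope code_scope with expr.
Bind Scope code_scope with cmd.
Local Notation "# n" := (Cst n) (at level 1, format "# n") : code_scope.
Local Notation "$ x" := (Var x) (at level 1, format "$ x") : code_scope.
Local Notation "a .[ e ]" := (Arr a e) : code_scope.
Local Notation "x + y" := (Bin OAdd x y) : code_scope.
Local Notation "x - y" := (Bin OSub x y) : code_scope.
Local Notation "x * y" := (Bin OMul x y) : code_scope.
Local Notation "x / y" := (Bin ODiv x y) : code_scope.
Local Notation "x ::= e" := (Asg x e) (at level 70, no associativity) : code_scope.
Local Notation "c ;; d" := (Seq c d) (at level 90, right associativity) : code_scope.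

(** At this point the bootstrap code has put [m] into [vm] and the first [nregs] input cells into
    [aI], so copying resumes at [nregs]. *)
Definition c_init : cmd := (
  vn ::= aI.[#0] ;; vk ::= aI.[#2] ;; vD ::= #2 * $vn ;; vT ::= #1 ;; vi ::= #nregs)%code.

Definition c_copy_body : cmd := (
  Sto aI $vi (Raw $vi) ;; vi ::= $vi + #1)%code.

(** Guards test for nonzero, so a comparison is expressed by truncated subtraction, here and in the
    loops below. *)
Definition e_copy : expr := (#3 * $vm + #3 - $vi)%code.

Definition e_sqrt : expr := ($vm + #1 - $vT * $vT)%code.

Definition c_sqrt_body : cmd := (vT ::= $vT + #1)%code.

Definition e_upto_m : expr := ($vm - $vi)%code.

Definition c_adj_body : cmd := (
  vi ::= $vi + #1 ;;
  vu ::= aI.[#3 * $vi] ;;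
  vx ::= aI.[#3 * $vi + #1] ;;
  Sto aA ($vu * $vn + $vx) $vi ;;
  Sto aA ($vx * $vn + $vu) $vi)%code.

Definition e_fill : expr := ($vm * $vn - $vi)%code.

(* The product is the edge number found in [aA] if all conditions of a conflict hold, else 0. *)
Definition e_entry (a b : nat) : expr := (
  aA.[$b * $vn + $vw] * aI.[#3 * aA.[$b * $vn + $vw] + #2]
  * (#1 - aI.[#3 * $ve + #2]) * (#1 - aA.[$a * $vn + $vw]))%code.

Definition c_fill_body : cmd := (
  ve ::= $vi / $vn + #1 ;;
  vw ::= $vi - $vi / $vn * $vn ;;
  vu ::= aI.[#3 * $ve] ;;
  vx ::= aI.[#3 * $ve + #1] ;;
  Sto aN ($ve * $vD + #2 * $vw) (e_entry vu vx) ;;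
  Sto aN ($ve * $vD + #2 * $vw + #1) (e_entry vx vu) ;;
  vi ::= $vi + #1)%code.

Definition e_auction : expr := ($vu + ($vm - $vs))%code.

Definition c_auction_skip : cmd := (Sto ap $vu (ap.[$vu] + #1))%code.

(** Each pass performs exactly one move of the auction, as [work] requires. The sum of the two
    truncated differences is nonzero iff price and bound differ. *)
Definition c_auction_body : cmd := (
  If $vu
    (If (($vD) - ap.[$vu])
      (vx ::= aN.[$vu * $vD + ap.[$vu]] ;;
       If $vx
         (If ((apr.[$vx] - ad.[$vu]) + (ad.[$vu] - apr.[$vx]))
           c_auction_skip
           (vw ::= aR.[$vx] ;;
            Sto aL $vw #0 ;;
            Sto aL $vu $vx ;;
            Sto aR $vx $vu ;;
            Sto apr $vx (apr.[$vx] + #1) ;;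
            vu ::= $vw))
         c_auction_skip)
      (Sto ad $vu (ad.[$vu] + #1) ;;
       Sto ap $vu #0 ;;
       If ($vT - ad.[$vu]) Skip (vu ::= #0)))
    (vs ::= $vs + #1 ;; vu ::= $vs))%code.

Definition c_roots_body : cmd := (
  vi ::= $vi + #1 ;;
  Sto apar $vi #0 ;;
  If (aL.[$vi]) Skip (Sto aQ $vqt $vi ;; vqt ::= $vqt + #1))%code.

(* By truncated subtraction the guard vanishes as soon as [vf] is set. *)
Definition e_search : expr := (($vqt - $vqh) * (#1 - $vf))%code.

Definition c_search_body : cmd := (
  If ($vD - $vj)
    (vu ::= aQ.[$vqh] ;;
     vx ::= aN.[$vu * $vD + $vj] ;;
     vj ::= $vj + #1 ;;
     If $vx
       (If (apar.[$vx]) Skip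
         (Sto apar $vx ($vqh + #1) ;;
          If (aR.[$vx])
            (Sto aQ $vqt (aR.[$vx]) ;; vqt ::= $vqt + #1)
            (vf ::= $vx)))
       Skip)
    (vqh ::= $vqh + #1 ;; vj ::= #0))%code.

Definition c_flip_body : cmd := (
  vu ::= aQ.[apar.[$vf] - #1] ;;
  vw ::= aL.[$vu] ;;
  Sto aL $vu $vf ;;
  Sto aR $vf $vu ;;
  vf ::= $vw)%code.

(** [vgo] remembers whether the search succeeded, because flipping drives [vf] to 0. *)
Definition c_round : cmd := (
  (vi ::= #0 ;; vqt ::= #0) ;;
  While e_upto_m c_roots_body ;;
  (vqh ::= #0 ;; vj ::= #0 ;; vf ::= #0) ;;
  While e_search c_search_body ;;
  (vgo ::= $vf) ;;
  While $vf c_flip_body)%code.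

Definition c_count_body : cmd := (
  vi ::= $vi + #1 ;;
  If (aL.[$vi]) (vx ::= $vx + #1) Skip)%code.

Definition program : cmd := (
  c_init ;;
  While e_copy c_copy_body ;;
  While e_sqrt c_sqrt_body ;;
  (vi ::= #0) ;;
  While e_upto_m c_adj_body ;;
  (vi ::= #0) ;;
  While e_fill c_fill_body ;;
  (vu ::= #0 ;; vs ::= #0) ;;
  While e_auction c_auction_body ;;
  (vgo ::= #1) ;;
  While $vgo c_round ;;
  (vi ::= #0 ;; vx ::= #0) ;;
  While e_upto_m c_count_body ;;
  (vAns ::= #1 - ($vx - $vk)))%code.

Lemma program_wf : wfc program.
Proof. by vm_compute. Qed.

(** * Verification of the program *)

Ltac conj := repeat (match goal with
  | |- _ /\ _ => split
  | |- and3 _ _ _ => split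
  | |- and4 _ _ _ _ => split
  | |- and5 _ _ _ _ _ => split
  | |- True => constructor
  end).

Section Verification.
Context (n : nat) (E : seq edge) (k : nat) (wfE : wf_graph n E).
Local Notation m := (size E).
Context (m_gt0 : 0 < m) (V B : nat).
Context (V_large : 64 * ((n + m + k + 2) * (n + m + k + 2)) <= V).
Context (B_large : 1024 * m <= B).
Local Notation raw := (input n E k).
Local Notation T := (Nat.sqrt m).+1.
Local Notation D := (2 * n).
Local Notation wpS := (@wp_spec V B raw).

Lemma T_sqr : m < T * T /\ (T.-1) * (T.-1) <= m.
Proof. by have := PeanoNat.Nat.sqrt_spec m; lia. Qed.

Lemma V_mul x y : x <= n + m + k + 2 -> y <= n + m + k + 2 -> 64 * (x * y) <= V.
Proof.
by move=> Hx Hy; apply: leq_trans V_large; rewrite leq_pmul2l //; exact: leq_mul.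
Qed.

Lemma V_lin : 128 * (n + m + k + 2) <= V.
Proof.
by have := @V_mul 2 (n + m + k + 2); lia.
Qed.

Lemma n_gt0 : 0 < n.
Proof. by have [] := @ed_lt n E wfE 1 (introT andP (conj isT m_gt0)); lia. Qed.

Lemma T_le : T <= m.+1.
Proof. by have [_] := T_sqr; nia. Qed.

Definition env (t : nat) (s : state) : Prop :=
  [/\ vr s vm = m, vr s vn = n, vr s vk = k, vr s vD = D & vr s vT = t].

Definition zeros (s : state) : Prop :=
  [/\ ar s aL =1 (fun=> 0), ar s aR =1 (fun=> 0), ar s ad =1 (fun=> 0),
      ar s ap =1 (fun=> 0) & ar s apr =1 (fun=> 0)].

Definition loaded (s : state) : Prop :=
  forall x, x < 3 * m + 3 -> ar s aI x = raw x.

Definition start (s : state) : Prop :=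
  [/\ vr s vm = m, forall x, x < nregs -> ar s aI x = raw x, ar s aA =1 (fun=> 0) & zeros s].

Lemma init_spec s : start s -> spec V B raw c_init s (tc c_init) (fun s =>
  [/\ env 1 s, vr s vi = nregs, forall x, x < nregs -> ar s aI x = raw x,
      ar s aA =1 (fun=> 0) & zeros s]).
Proof.
move=> [h1 h2 h3 h4]; apply: wpS; rewrite /c_init /=.
have := V_lin; have := m_gt0 => Hm HV.
rewrite !h2 // /input /encode /=.
by rewrite /nregs; do ! split => //=; lia.
Qed.

Lemma copy_spec s :
  [/\ env 1 s, vr s vi = nregs, forall x, x < nregs -> ar s aI x = raw x,
      ar s aA =1 (fun=> 0) & zeros s] ->
  spec V B raw (While e_copy c_copy_body) s
    ((3 * m + 4) * (esz e_copy + tc c_copy_body + 3))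
    (fun s => [/\ env 1 s, loaded s, ar s aA =1 (fun=> 0) & zeros s]).
Proof.
move=> [h1 h2 h3 h4 h5].
(* There is no upper bound on [vi]: on a short input it starts beyond the last input cell. *)
pose I s := [/\ env 1 s, nregs <= vr s vi, forall x, x < vr s vi -> ar s aI x = raw x,
  ar s aA =1 (fun=> 0) & zeros s].
have HV := V_lin.
have W := @spec_while V B raw e_copy c_copy_body (tc c_copy_body) I
  (fun s => [/\ env 1 s, loaded s, ar s aA =1 (fun=> 0) & zeros s])
  (fun s => 3 * m + 3 - vr s vi) s.
apply: (spec_weaken (W _ _ _ _)) => {W} //.
- move=> s1 [[c1 c2 c3 c4 c5] i1 i2 i3 i4] /=; rewrite c1; lia.
- move=> s1 [[c1 c2 c3 c4 c5] i1 i2 i3 i4] /=; rewrite c1 => Hi.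
  by split=> // x Hx; apply: i2; lia.
- move=> s1 [[c1 c2 c3 c4 c5] i1 i2 i3 i4] /=; rewrite c1 => Hi.
  apply: wpS; rewrite /c_copy_body /=.
  have Hlt : vr s1 vi < B by lia.
  rewrite i1 Hlt; do ! split => //=; try lia.
  move=> x Hx; rewrite updE; case: eqP => [->|Hne] //; apply: i2; lia.
- by split=> //; rewrite h2.
- by rewrite leq_mul2r; apply/orP; right; lia.
Qed.

Lemma sqrt_spec s :
  [/\ env 1 s, loaded s, ar s aA =1 (fun=> 0) & zeros s] ->
  spec V B raw (While e_sqrt c_sqrt_body) s
    ((m + 1) * (esz e_sqrt + tc c_sqrt_body + 3))
    (fun s => [/\ env T s, loaded s, ar s aA =1 (fun=> 0) & zeros s]).
Proof.
move=> [h1 h2 h3 h4].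
pose I s := [/\ env (vr s vT) s, 0 < vr s vT /\ (vr s vT).-1 * (vr s vT).-1 <= m,
  loaded s, ar s aA =1 (fun=> 0) & zeros s].
have HV := V_lin.
have W := @spec_while V B raw e_sqrt c_sqrt_body (tc c_sqrt_body) I
  (fun s => [/\ env T s, loaded s, ar s aA =1 (fun=> 0) & zeros s])
  (fun s => m + 1 - vr s vT) s.
have bnd t : 0 < t -> t.-1 * t.-1 <= m -> t <= m.+1 by nia.
apply: (spec_weaken (W _ _ _ _)) => {W} //.
- move=> s1 [[c1 c2 c3 c4 c5] [i1 i1'] i2 i3 i4] /=; rewrite c1.
  have Ht := bnd _ i1 i1'.
  have v : 64 * (vr s1 vT * vr s1 vT) <= V by apply: V_mul; lia.
  by do ! split => //=; lia.
- move=> s1 [[c1 c2 c3 c4 c5] [i1 i1'] i2 i3 i4] /=; rewrite c1 => Hi.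
  split=> //; split=> //; suff : Nat.sqrt m = (vr s1 vT).-1 by lia.
  have Et : Nat.sqrt m = (vr s1 vT).-1 by apply: PeanoNat.Nat.sqrt_unique; nia.
  by rewrite /env; conj; rewrite // Et prednK.
- move=> s1 [[c1 c2 c3 c4 c5] [i1 i1'] i2 i3 i4] /=; rewrite c1 => Hi.
  have Ht := bnd _ i1 i1'.
  have Hlt : vr s1 vT < m + 1 by nia.
  apply: wpS; rewrite /c_sqrt_body /= addn1 /=.
  do ! split => //=; lia.
- by case: h1 => c1 c2 c3 c4 c5; split=> //; rewrite c5.
- by rewrite leq_mul2r; apply/orP; right; case: h1 => _ _ _ _ ->; lia.
Qed.

Lemma adj_spec s :
  [/\ env T s, vr s vi = 0, loaded s, ar s aA =1 (fun=> 0) & zeros s] ->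
  spec V B raw (While e_upto_m c_adj_body) s
    (m.+1 * (esz e_upto_m + tc c_adj_body + 3))
    (fun s => [/\ env T s, loaded s, adj n E m (ar s aA) & zeros s]).
Proof.
move=> [h1 h2 h3 h4 h5].
pose I s := [/\ env T s, vr s vi <= m, loaded s, adj n E (vr s vi) (ar s aA) & zeros s].
have HV := V_lin.
have W := @spec_while V B raw e_upto_m c_adj_body (tc c_adj_body) I
  (fun s => [/\ env T s, loaded s, adj n E m (ar s aA) & zeros s])
  (fun s => m - vr s vi) s.
apply: (spec_weaken (W _ _ _ _)) => {W} //.
- move=> s1 [[c1 c2 c3 c4 c5] i1 i2 i3 i4] /=; rewrite c1 => Hi.
  by split=> //; have -> : m = vr s1 vi by lia.
- move=> s1 [[c1 c2 c3 c4 c5] i1 i2 i3 i4] /=; rewrite c1 => Hi.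
  apply: wpS; rewrite /c_adj_body /= addn1.
  have He : 0 < (vr s1 vi).+1 <= m by lia.
  have [e1 e2 _] := input_edge n k He.
  have [l1 l2] := ed_lt wfE He.
  rewrite !i2; try by lia.
  rewrite e1 e2 c2.
  have v1 : 64 * ((ed E (vr s1 vi).+1).1.1 * n) <= V by apply: V_mul; lia.
  have v2 : 64 * ((ed E (vr s1 vi).+1).1.2 * n) <= V by apply: V_mul; lia.
  rewrite /I /env /=; conj; rewrite //=; try lia.
  by apply: (adj_step wfE); [lia|exact: i3].
- by rewrite /I h2; split=> //; exact: adj_init.
- by rewrite leq_mul2r; apply/orP; right; rewrite h2 subn0.
Qed.


Lemma entry_spec s a b :
  vr s vn = n -> loaded s -> adj n E m (ar s aA) -> 0 < vr s ve <= m -> vr s vw < n ->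
  vr s a < n -> vr s b < n ->
  safe V B raw s (e_entry a b) /\
  eval raw s (e_entry a b) = entry n E k (ar s aA) (vr s ve) (vr s a) (vr s b) (vr s vw).
Proof.
move=> c2 hI hA He Hw Ha Hb; rewrite /e_entry /entry /= c2.
set y := ar s aA (vr s b * n + vr s vw).
have HV := V_lin.
have va : 64 * (vr s a * n) <= V by apply: V_mul; lia.
have vb : 64 * (vr s b * n) <= V by apply: V_mul; lia.
have Hy : y <= m.
  case: (y =P 0) => [->//|Hy]; by case: (adj_joins hA Hb Hw Hy).
rewrite !hI; [|lia|lia].
(* For [y = 0] the second factor is [k], but the product still vanishes. *)
have Hc : y * raw (3 * y + 2) <= m.
  case: (y =P 0) => [->//|Hy0].
  have [_ _ ->] := @input_edge n E k y (ltac:(lia)).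
  by case: (ed E y).2; lia.
split=> //; set z := y * raw _ in Hc *.
have Hz t : z * (1 - t) <= m by nia.
have Hz' t t' : z * (1 - t) * (1 - t') <= m by have := Hz t; nia.
have h1 := Hz (raw (3 * vr s ve + 2)).
have h2 := Hz' (raw (3 * vr s ve + 2)) (ar s aA (vr s a * n + vr s vw)).
by rewrite -/z; conj; lia.
Qed.

Definition tabled (nb : nat -> nat) : Prop :=
  (forall u j, 0 < u <= m -> j < D -> nb (u * D + j) <= m) /\
  (forall u x, 0 < u <= m -> arc nb D u x <-> conflict E u x).

Lemma fill_spec s :
  [/\ env T s, vr s vi = 0, loaded s, adj n E m (ar s aA) & zeros s] ->
  spec V B raw (While e_fill c_fill_body) s
    ((m * n).+1 * (esz e_fill + tc c_fill_body + 3))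
    (fun s => [/\ env T s, tabled (ar s aN) & zeros s]).
Proof.
move=> [h1 h2 h3 h4 h5].
pose I s := [/\ env T s, vr s vi <= m * n, loaded s, adj n E m (ar s aA) /\
  filled n E k (ar s aA) (vr s vi) (ar s aN) & zeros s].
have HV := V_lin.
have vmn : 64 * (m * n) <= V by apply: V_mul; lia.
have W := @spec_while V B raw e_fill c_fill_body (tc c_fill_body) I
  (fun s => [/\ env T s, tabled (ar s aN) & zeros s])
  (fun s => m * n - vr s vi) s.
apply: (spec_weaken (W _ _ _ _)) => {W} //.
- move=> s1 [[c1 c2 c3 c4 c5] i1 i2 i3 i4] /=; rewrite c1 c2; conj; lia.
- move=> s1 [[c1 c2 c3 c4 c5] i1 i2 [i3 i3'] i4] /=; rewrite c1 c2 => Hi.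
  have Ei : vr s1 vi = m * n by lia.
  rewrite Ei in i3'.
  split=> //; split.
    by move=> u j; exact: table_le i3 _ i3' _ _.
  by move=> u x; exact: table_arc i3 _ i3' _ _.
- move=> s1 [[c1 c2 c3 c4 c5] i1 i2 [i3 i3'] i4] /=; rewrite c1 c2 => Hi.
  apply: wpS; rewrite /c_fill_body.
  (* The two table expressions stay opaque; [entry_spec] evaluates them in the intermediate states
     in which they occur. *)
  move Ea: (e_entry vu vx) => ea; move Eb: (e_entry vx vu) => eb /=; rewrite !c2 c4.
  set q := vr s1 vi %/ n; set w := vr s1 vi - q * n.
  have Hn := n_gt0.
  have Hq : q < m by rewrite /q ltn_divLR //; lia.
  have Hw : w < n.
    by rewrite /w /q; have := ltn_ceil (vr s1 vi) Hn; rewrite mulSn; lia.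
  have He : 0 < q + 1 <= m by lia.
  have [e1 e2 _] := input_edge n k He.
  have [l1 l2] := ed_lt wfE He.
  rewrite !i2; try by lia.
  rewrite !e1 !e2.
  set st1 := setv _ vx _; set st2 := seta _ _ _ _.
  have [|s1a s1b] := @entry_spec st1 vu vx c2 i2 i3 _ Hw l1 l2; first by rewrite /= ; lia.
  have [|s2a s2b] := @entry_spec st2 vx vu c2 i2 i3 _ Hw l2 l1; first by rewrite /= ; lia.
  have Hm1 : (q + 1) * D <= 2 * (m * n).
    by rewrite mulnCA leq_mul2l leq_mul2r; apply/orP; right; apply/orP; right; lia.
  have Hq2 : q * n <= vr s1 vi by exact: leq_trunc_div.
  rewrite Ea in s1a s1b; rewrite Eb in s2a s2b.
  conj; rewrite //=; try lia.
  rewrite /I /env /=; conj; rewrite //=; try lia.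
  rewrite s1b s2b /= (addn1 (vr s1 vi)) (addn1 q).
  by apply: filled_step i3'; lia.
- rewrite /I h2; conj => // e w; lia.
- by rewrite leq_mul2r; apply/orP; right; rewrite h2 subn0.
Qed.

Section Table.
Context (nb : nat -> nat) (nbT : tabled nb).
Let nb_le := proj1 nbT.

(** Division-free form of a deficit of at most m/T. *)
Definition near_optimal (mL : nat -> nat) : Prop :=
  forall mL' mR', matching nb D m 0 mL' mR' -> T * msize m mL' <= T * msize m mL + m.

Definition auction_time : nat :=
  (m * (T * D.+1 + D) + m * T + m).+1 * (esz e_auction + tc c_auction_body + 3).

Lemma slot_lt u j : u <= m -> j <= D -> u * D + j + 3 < V.
Proof.
move=> Hu Hj; have HV := V_lin.
have v : 64 * (m * n) <= V by apply: V_mul; lia.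
have : u * D <= m * D by rewrite leq_mul2r Hu orbT.
by rewrite mulnCA; lia.
Qed.

Lemma auction_spec s :
  [/\ env T s, ar s aN = nb, zeros s, vr s vu = 0 & vr s vs = 0] ->
  spec V B raw (While e_auction c_auction_body) s auction_time
    (fun s => [/\ env T s, ar s aN = nb, matching nb D m 0 (ar s aL) (ar s aR)
       & near_optimal (ar s aL)]).
Proof.
move=> [h1 h2 h3 h4 h5].
pose I s := [/\ env T s, ar s aN = nb &
  auction nb D m T (vr s vu) (vr s vs) (ar s aL) (ar s aR) (ar s ad) (ar s ap) (ar s apr)].
have HV := V_lin.
have HT := T_le.
pose F s := work D m (vr s vs) (ar s ad) (ar s ap) (ar s apr).
have W := @spec_while V B raw e_auction c_auction_body (tc c_auction_body) I
  (fun s => [/\ env T s, ar s aN = nb, matching nb D m 0 (ar s aL) (ar s aR)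
       & near_optimal (ar s aL)])
  (fun s => m * (T * D.+1 + D) + m * T + m - F s) s.
(* The truncated difference really drops because, by [work_bound], the new potential is still within
   the bound. *)
have mu_lt s1 s2 : I s2 -> F s2 = (F s1).+1 ->
    m * (T * D.+1 + D) + m * T + m - F s2 < m * (T * D.+1 + D) + m * T + m - F s1.
  by case=> _ _ /work_bound; rewrite -/(F s2); lia.
apply: (spec_weaken (W _ _ _ _)) => {W} //.
- move=> s1 [[c1 c2 c3 c4 c5] i1 i2] /=; rewrite c1.
  by have := a_us i2; have := a_sm i2; conj; lia.
- move=> s1 [[c1 c2 c3 c4 c5] i1 i2] /=; rewrite c1 => Hi.
  have Hs : vr s1 vs = m by have := a_sm i2; lia.
  have Hu : vr s1 vu = 0 by lia.
  rewrite Hs Hu in i2.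
  split=> //; first exact: a_match i2.
  by move=> mL' mR'; exact: (auction_near_optimal nb_le i2).
- move=> s1 [[c1 c2 c3 c4 c5] i1 i2] /=; rewrite c1 => Hi.
  have us := a_us i2; have sm' := a_sm i2.
  apply: wpS; rewrite /c_auction_body /c_auction_skip /= c4 c5 i1.
  split=> // [Hu|Hu]; last first.
    have Hs : vr s1 vs < m by lia.
    rewrite Hu in i2; have A' := auction_next (ltn0Sn _) Hs i2.
    conj; try lia; rewrite !addn1 => //.
    apply: mu_lt; first by rewrite /I /env; conj.
    by rewrite /F /= /work; lia.
  have Hum : 0 < vr s1 vu <= m by lia.
  have dT := a_d i2 Hum; have pD := a_p i2 Hum.
  split=> // [Hp|Hp]; last first.
    have Hp' : ar s1 ap (vr s1 vu) = D by lia.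
    have A' := auction_raise Hu Hp' i2.
    have E' : work D m (vr s1 vs) (upd (ar s1 ad) (vr s1 vu) (ar s1 ad (vr s1 vu)).+1)
       (upd (ar s1 ap) (vr s1 vu) 0) (ar s1 apr) = (F s1).+1 by exact: work_raise.
    rewrite !addn1 !upd_same; conj; try lia; move=> Ht.
      have Hne : ((ar s1 ad (vr s1 vu)).+1 == T) = false by lia.
      rewrite Hne in A'; have I' : I (seta (seta s1 ad (vr s1 vu)
        (ar s1 ad (vr s1 vu)).+1) ap (vr s1 vu) 0) by rewrite /I /env; conj.
      by split=> //; exact: mu_lt.
    have Hne : ((ar s1 ad (vr s1 vu)).+1 == T) = true.
      by have := a_cur i2 Hu; lia.
    rewrite Hne in A'; have I' : I (setv (seta (seta s1 ad (vr s1 vu)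
      (ar s1 ad (vr s1 vu)).+1) ap (vr s1 vu) 0) vu 0) by rewrite /I /env; conj.
    by split; [lia|split=> //; exact: mu_lt].
  have Hp' : ar s1 ap (vr s1 vu) < D by lia.
  have Hsl := slot_lt (proj2 (andP Hum)) pD.
  have Hx := nb_le Hum Hp'.
  set x := nb _ in Hx *.
  have pS : ar s1 ap (vr s1 vu) + 1 < V by lia.
  have skip : (x <> 0 -> ar s1 apr x <> ar s1 ad (vr s1 vu)) ->
      I (seta (setv s1 vx x) ap (vr s1 vu) (ar s1 ap (vr s1 vu)).+1).
    by move=> H; rewrite /I /env; conj => //; exact: auction_skip.
  have skip_mu : (x <> 0 -> ar s1 apr x <> ar s1 ad (vr s1 vu)) ->
      m * (T * D.+1 + D) + m * T + m -
        F (seta (setv s1 vx x) ap (vr s1 vu) (ar s1 ap (vr s1 vu)).+1) <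
      m * (T * D.+1 + D) + m * T + m - F s1.
    by move=> H; apply: mu_lt (skip H) _; exact: work_skip.
  split; first by conj; lia.
  split=> // [x0|x0]; last first.
    rewrite !addn1; conj; try lia; by [apply: skip|apply: skip_mu].
  have Hxm : 0 < x <= m by lia.
  have pT := a_pr i2 Hxm.
  split; [by conj; lia|move=> Hd|move=> Hd].
    have Hne : x <> 0 -> ar s1 apr x <> ar s1 ad (vr s1 vu) by lia.
    rewrite !addn1; conj; try lia; by [apply: skip|apply: skip_mu].
  have Heq : ar s1 apr x = ar s1 ad (vr s1 vu) by lia.
  have A' := auction_bid nb_le Hu Hp' (erefl x) x0 Heq i2.
  rewrite !addn1; conj; try lia; first by rewrite /I /env; conj.
  by apply: mu_lt; [rewrite /I /env; conj|exact: work_bid].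
- rewrite /I h4 h5; split=> //; case: h3 => z1 z2 z3 z4 z5.
  exact: auction_init.
- by rewrite leq_mul2r; apply/orP; right; rewrite ltnS leq_subr.
Qed.

Definition stage (mL mR : nat -> nat) (s : state) : Prop :=
  [/\ env T s, ar s aN = nb, ar s aL = mL & ar s aR = mR].

Lemma roots_spec mL mR s :
  [/\ stage mL mR s, vr s vi = 0 & vr s vqt = 0] ->
  spec V B raw (While e_upto_m c_roots_body) s
    (m.+1 * (esz e_upto_m + tc c_roots_body + 3))
    (fun s => stage mL mR s /\ roots m m (vr s vqt) mL (ar s aQ) (ar s apar)).
Proof.
move=> [h1 h2 h3].
pose I s := stage mL mR s /\ roots m (vr s vi) (vr s vqt) mL (ar s aQ) (ar s apar).
have HV := V_lin.
have W := @spec_while V B raw e_upto_m c_roots_body (tc c_roots_body) I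
  (fun s => stage mL mR s /\ roots m m (vr s vqt) mL (ar s aQ) (ar s apar))
  (fun s => m - vr s vi) s.
apply: (spec_weaken (W _ _ _ _)) => {W} //.
- move=> s1 [[[c1 c2 c3 c4 c5] i1 i2 i3] R] /=; rewrite c1 => Hi; split=> //.
  have Hm := r_im R; have Ei : vr s1 vi = m by lia.
  by rewrite Ei in R.
- move=> s1 [[[c1 c2 c3 c4 c5] i1 i2 i3] R] /=; rewrite c1 => Hi.
  have Hm := r_im R; have Hq := r_qt R; have Hlt : vr s1 vi < m by lia.
  apply: wpS; rewrite /c_roots_body /= i2 !addn1.
  conj; try lia; move=> Hx.
    have R' := roots_matched Hlt Hx R.
    by rewrite /I /stage /env; conj => //; lia.
  have R' := roots_free Hlt Hx R.
  by rewrite /I /stage /env; conj => //; lia.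
- by split=> //; rewrite h2 h3; split=> // u; lia.
- by rewrite leq_mul2r; apply/orP; right; rewrite h2 subn0.
Qed.

Lemma search_spec mL mR s :
  [/\ stage mL mR s, vr s vqh = 0, vr s vj = 0, vr s vf = 0 &
     matching nb D m 0 mL mR /\ roots m m (vr s vqt) mL (ar s aQ) (ar s apar)] ->
  spec V B raw (While e_search c_search_body) s
    ((2 * m * D.+1 + D).+2 * (esz e_search + tc c_search_body + 3))
    (fun s => [/\ stage mL mR s, vr s vf = 0 -> vr s vqh = vr s vqt &
      search nb D m (vr s vqh) (vr s vqt) (vr s vj) (vr s vf) mL mR (ar s aQ) (ar s apar)]).
Proof.
move=> [h1 h2 h3 h4 [M h5]].
pose I s := stage mL mR s /\
  search nb D m (vr s vqh) (vr s vqt) (vr s vj) (vr s vf) mL mR (ar s aQ) (ar s apar).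
have HV := V_lin.
(* Scan position, with [D.+1] units per queue entry: [D] slots and the step to the next entry. *)
pose F s := vr s vqh * D.+1 + vr s vj.
have W := @spec_while V B raw e_search c_search_body (tc c_search_body) I
  (fun s => [/\ stage mL mR s, vr s vf = 0 -> vr s vqh = vr s vqt &
      search nb D m (vr s vqh) (vr s vqt) (vr s vj) (vr s vf) mL mR (ar s aQ) (ar s apar)])
  (fun s => (2 * m * D.+1 + D).+1 - F s) s.
have F_le s1 : I s1 -> F s1 <= 2 * m * D.+1 + D.
  move=> [_ S]; rewrite /F; have H1 := search_bound S.
  have H2 := s_q S; have H3 := s_j S.
  by apply: leq_add => //; rewrite leq_mul2r; apply/orP; right; lia.
have mu_lt s1 s2 : I s2 -> F s2 = (F s1).+1 ->
    (2 * m * D.+1 + D).+1 - F s2 < (2 * m * D.+1 + D).+1 - F s1.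
  by move/F_le; lia.
apply: (spec_weaken (W _ _ _ _)) => {W} //.
- move=> s1 [_ S] /=; have := search_bound S => Hb.
  have : (vr s1 vqt - vr s1 vqh) * (1 - vr s1 vf) <= vr s1 vqt by nia.
  by conj; lia.
- move=> s1 [St S] /= Hi; split=> // Hf.
  by have := s_q S; move: Hi; rewrite Hf; lia.
- move=> s1 [[[c1 c2 c3 c4 c5] i1 i2 i3] S] /= Hi.
  have Hf : vr s1 vf = 0 by case: (vr s1 vf) Hi => // f; rewrite subSS sub0n muln0.
  have Hq : vr s1 vqh < vr s1 vqt by move: Hi; rewrite Hf; lia.
  have Hb := search_bound S; have Hj := s_j S.
  have [Qm _] := s_tree S Hq.
  have Hsl := slot_lt (proj2 (andP Qm)) Hj.
  apply: wpS; rewrite /c_search_body /= c4 i1 !i3 !addn1.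
  split=> // [Hj'|Hj']; last first.
    have Ej : vr s1 vj = D by lia.
    rewrite Ej in S; have S' := search_pop Hq S.
    have I' : I (setv (setv s1 vqh (vr s1 vqh).+1) vj 0).
      by rewrite /I /stage /env /=; conj.
    conj; try lia; first exact: I'.
    by apply: mu_lt I' _; rewrite /F /= Ej; lia.
  have Hj2 : vr s1 vj < D by lia.
  have Hx := nb_le Qm Hj2.
  set u := ar s1 aQ (vr s1 vqh) in Qm Hsl Hx *.
  set x := nb _ in Hx *.
  have Fs s2 : vr s2 vqh = vr s1 vqh -> vr s2 vj = (vr s1 vj).+1 -> F s2 = (F s1).+1.
    by move=> E1 E2; rewrite /F E1 E2 addnS.
  have skip : (x <> 0 -> ar s1 apar x <> 0) ->
      I (setv (setv (setv s1 vu u) vx x) vj (vr s1 vj).+1).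
    move=> H; have S' := search_skip Hj2 H S.
    by rewrite /I /stage /env /=; conj.
  split=> //; split; first by conj; lia.
  split; first by conj; lia.
  split=> // [x0|x0]; last first.
    have I' := skip (fun H => False_ind _ (H x0)).
    by split; [exact: I'|apply: mu_lt I' _; exact: Fs].
  split=> // [Hp|Hp].
    have I' := skip (fun _ => Hp).
    by split; [exact: I'|apply: mu_lt I' _; exact: Fs].
  have := search_visit nb_le Hq Hj2 (erefl x) x0 Hp Hf S.
  case: eqP => Hm S'; conj; try lia; move=> // _.
    set s2 := setv _ vf _; have I' : I s2 by rewrite /I /stage /env /=; conj.
    by split=> //; split; [exact: I'|apply: mu_lt I' _; exact: Fs].
  set s2 := setv _ vqt _; have I' : I s2.
    by rewrite /I /stage /env /= Hf; conj.
  by conj; try lia; [exact: I'|apply: mu_lt I' _; exact: Fs].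
- by rewrite /I h2 h3 h4; split=> //; exact: search_init.
- by rewrite leq_mul2r; apply/orP; right; rewrite ltnS leq_subr.
Qed.

(** The variant is [par] of the hole, which [flip_step] lowers and which starts at most at the
    length of the queue. *)
Lemma flip_spec c s : env T s -> ar s aN = nb -> ar s apar (vr s vf) <= 2 * m ->
  flip nb D m (vr s vf) c (ar s aL) (ar s aR) (ar s aQ) (ar s apar) ->
  spec V B raw (While (Var vf) c_flip_body) s
    ((2 * m).+1 * (esz (Var vf) + tc c_flip_body + 3))
    (fun s' => [/\ env T s', ar s' aN = nb, vr s' vgo = vr s vgo,
      matching nb D m 0 (ar s' aL) (ar s' aR) & msize m (ar s' aL) = c]).
Proof.
move=> h1 h2 h3 h4.
pose I s' := [/\ env T s', ar s' aN = nb, vr s' vgo = vr s vgo &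
  flip nb D m (vr s' vf) c (ar s' aL) (ar s' aR) (ar s' aQ) (ar s' apar)].
have HV := V_lin.
have W := @spec_while V B raw (Var vf) c_flip_body (tc c_flip_body) I
  (fun s' => [/\ env T s', ar s' aN = nb, vr s' vgo = vr s vgo,
      matching nb D m 0 (ar s' aL) (ar s' aR) & msize m (ar s' aL) = c])
  (fun s' => if vr s' vf == 0 then 0 else ar s' apar (vr s' vf)) s.
apply: (spec_weaken (W _ _ _ _)) => {W} //.
- move=> s1 [i1 i2 i3 i4] /= Hv; rewrite Hv in i4; split=> //.
    exact: f_match i4.
  by have := f_size i4; rewrite addn0.
- move=> s1 [[c1 c2 c3 c4 c5] i2 i3 i4] /= Hv.
  have [i4' Hlt] := flip_step nb_le Hv i4.
  have Hp := f_v0 i4 Hv.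
  apply: wpS; rewrite /c_flip_body /=.
  rewrite subn1; split; first by conj; lia.
  conj => //.
  rewrite (introF eqP Hv); case: eqP => [_|/Hlt //]; lia.
- by rewrite leq_mul2r; apply/orP; right; rewrite ltnS; case: ifP.
Qed.

Definition covered (mL : nat -> nat) : Prop :=
  exists pk : nat -> nat, (forall u, pk u = u \/ pk u = mL u) /\
  forall u x, 0 < u <= m -> arc nb D u x ->
    exists y, [/\ 0 < y <= m, mL y <> 0 & pk y = u \/ pk y = x].

Definition round_time : nat :=
  tc (Seq (Asg vi (Cst 0)) (Asg vqt (Cst 0))) +
  (m.+1 * (esz e_upto_m + tc c_roots_body + 3) +
  (tc (Seq (Asg vqh (Cst 0)) (Seq (Asg vj (Cst 0)) (Asg vf (Cst 0)))) +
  ((2 * m * D.+1 + D).+2 * (esz e_search + tc c_search_body + 3) +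
  (tc (Asg vgo (Var vf)) +
  (2 * m).+1 * (esz (Var vf) + tc c_flip_body + 3))))).

Lemma round_spec s : env T s -> ar s aN = nb ->
  matching nb D m 0 (ar s aL) (ar s aR) ->
  spec V B raw c_round s round_time
    (fun s' => [/\ env T s', ar s' aN = nb, matching nb D m 0 (ar s' aL) (ar s' aR),
      vr s' vgo <> 0 -> msize m (ar s' aL) = (msize m (ar s aL)).+1
      & vr s' vgo = 0 -> covered (ar s' aL) /\ msize m (ar s' aL) = msize m (ar s aL)]).
Proof.
move=> h1 h2 M; set mL := ar s aL in M *; set mR := ar s aR in M.
have HV := V_lin.
apply: (@spec_seq _ _ _ _ _ _ _ _ _
    (fun s1 => [/\ stage mL mR s1, vr s1 vi = 0 & vr s1 vqt = 0])).
  by apply: wpS; case: h1 => *; rewrite /stage /env /=; conj => //; lia.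
move=> s1 H1; apply: spec_seq (roots_spec H1) _ => {H1} s2 [H2 R].
apply: (@spec_seq _ _ _ _ _ _ _ _ _
    (fun s1 => [/\ stage mL mR s1, vr s1 vqh = 0, vr s1 vj = 0, vr s1 vf = 0 &
     matching nb D m 0 mL mR /\ roots m m (vr s1 vqt) mL (ar s1 aQ) (ar s1 apar)])).
  apply: wpS; case: H2 => -[c1 c2 c3 c4 c5] i1 i2 i3.
  by rewrite /stage /env /=; conj => //; lia.
move=> s3 H3; apply: spec_seq (search_spec H3) _ => {s1 s2 R H2 H3 s3} s3 [H3 Hex S].
have Hb := search_bound S.
apply: (@spec_seq _ _ _ _ _ _ _ _ _
    (fun s1 => [/\ stage mL mR s1, vr s1 vgo = vr s1 vf, vr s1 vf = 0 -> vr s1 vqh = vr s1 vqt &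
      search nb D m (vr s1 vqh) (vr s1 vqt) (vr s1 vj) (vr s1 vf) mL mR (ar s1 aQ) (ar s1 apar)])).
  apply: wpS; case: H3 => -[c1 c2 c3 c4 c5] i1 i2 i3.
  by rewrite /stage /env /=; conj.
move=> {s3 H3 Hex S Hb} s3 [[H3 i1 i2 i3] Hgo Hex S].
have Hb := search_bound S.
have [Hf|/eqP Hf] := eqVneq (vr s3 vf) 0.
  have Hcov : covered mL.
    rewrite Hf (Hex Hf) in S; exists (pick mL (ar s3 apar)); split.
      by move=> u; rewrite /pick; case: ifP; auto.
    by move=> u x Hu Ha; exact: (search_cover nb_le S Hu Ha).
  exists (esz (Var vf) + 1), s3; split.
  - exact: ev_while0.
  - have : 0 < m.+1 by []. nia.
  - by split; rewrite ?i2 ?i3 ?Hgo ?Hf.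
have [[Hfm Hp _]] := s_found S Hf.
apply: spec_weaken (flip_spec (c := (msize m mL).+1) H3 i1 _ _) _ _ => //.
- by have [H _] := s_par S Hfm Hp; lia.
- by rewrite i2 i3; exact: flip_init S.
- by move=> s4 [j1 j2 j3 j4 j5]; split=> //; rewrite j3 Hgo.
Qed.

Lemma rounds_spec s :
  [/\ env T s, ar s aN = nb, matching nb D m 0 (ar s aL) (ar s aR),
     near_optimal (ar s aL) & vr s vgo = 1] ->
  spec V B raw (While (Var vgo) c_round) s
    (T.+1 * (esz (Var vgo) + round_time + 3))
    (fun s => [/\ env T s, ar s aN = nb, matching nb D m 0 (ar s aL) (ar s aR)
       & covered (ar s aL)]).
Proof.
move=> [h1 h2 h3 h4 h5]; set M1 := msize m (ar s aL).
pose I s := [/\ env T s, ar s aN = nb, matching nb D m 0 (ar s aL) (ar s aR),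
  M1 <= msize m (ar s aL) & vr s vgo = 0 -> covered (ar s aL)].
(* Since [m < T * T], near-optimality gives [T * msize m mL < T * (M1 + T)]. So fewer than [T]
   rounds can succeed, and the failing one clears [vgo] and thereby the variant. *)
have opt mL mR : matching nb D m 0 mL mR -> msize m mL < M1 + T.
  move/h4; rewrite -/M1 => H; have [HT _] := T_sqr.
  rewrite -(@ltn_pmul2l T) // mulnDr; apply: leq_ltn_trans H _.
  by rewrite ltn_add2l.
have W := @spec_while V B raw (Var vgo) c_round round_time I
  (fun s => [/\ env T s, ar s aN = nb, matching nb D m 0 (ar s aL) (ar s aR)
       & covered (ar s aL)])
  (fun s => if vr s vgo == 0 then 0 else M1 + T - msize m (ar s aL)) s.
apply: (spec_weaken (W _ _ _ _)) => {W} //.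
- by move=> s1 [i1 i2 i3 i4 i5] /i5.
- move=> s1 [i1 i2 i3 i4 i5] /= /eqP/negbTE->.
  apply: spec_weaken (round_spec i1 i2 i3) _ _ => // s2 [j1 j2 j3 j4 j5].
  have o1 := opt _ _ i3; have o2 := opt _ _ j3.
  case: (vr s2 vgo =P 0) => Hgo.
    have [jc jm] := j5 Hgo; split; first by split=> //; rewrite jm.
    by lia.
  have jm := j4 Hgo; split; last by lia.
  by split=> //; lia.
- by split=> //; rewrite h5.
- by rewrite leq_mul2r; apply/orP; right; rewrite h5 /= -/M1; lia.
Qed.

Lemma count_spec mL s : [/\ env T s, ar s aL = mL, vr s vi = 0 & vr s vx = 0] ->
  spec V B raw (While e_upto_m c_count_body) s
    (m.+1 * (esz e_upto_m + tc c_count_body + 3))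
    (fun s => env T s /\ vr s vx = msize m mL).
Proof.
move=> [h1 h2 h3 h4].
pose I s := [/\ env T s, ar s aL = mL, vr s vi <= m & vr s vx = msize (vr s vi) mL].
have HV := V_lin.
have W := @spec_while V B raw e_upto_m c_count_body (tc c_count_body) I
  (fun s => env T s /\ vr s vx = msize m mL)
  (fun s => m - vr s vi) s.
apply: (spec_weaken (W _ _ _ _)) => {W} //.
- move=> s1 [[c1 c2 c3 c4 c5] i1 i2 i3] /=; rewrite c1 => Hi.
  by split=> //; rewrite i3; congr msize; lia.
- move=> s1 [[c1 c2 c3 c4 c5] i1 i2 i3] /=; rewrite c1 => Hi.
  have Hs : msize (vr s1 vi).+1 mL = msize (vr s1 vi) mL + (mL (vr s1 vi).+1 != 0).
    by rewrite /msize -[(vr s1 vi).+1 in LHS]addn1 iotaD count_cat /= addn0 add1n.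
  have Hle := msize_le (vr s1 vi) mL.
  apply: wpS; rewrite /c_count_body /= i1 !addn1.
  conj; try lia; move=> Hx; rewrite /I /env /=; conj; rewrite //=; lia.
- by rewrite /I h3 h4.
- by rewrite leq_mul2r; apply/orP; right; rewrite h3 subn0.
Qed.

End Table.

Definition program_time : nat :=
  tc c_init + ((3 * m + 4) * (esz e_copy + tc c_copy_body + 3) +
  ((m + 1) * (esz e_sqrt + tc c_sqrt_body + 3) +
  (tc (Asg vi (Cst 0)) + (m.+1 * (esz e_upto_m + tc c_adj_body + 3) +
  (tc (Asg vi (Cst 0)) + ((m * n).+1 * (esz e_fill + tc c_fill_body + 3) +
  (tc (Seq (Asg vu (Cst 0)) (Asg vs (Cst 0))) + (auction_time +
  (tc (Asg vgo (Cst 1)) + (T.+1 * (esz (Var vgo) + round_time + 3) +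
  (tc (Seq (Asg vi (Cst 0)) (Asg vx (Cst 0))) +
  (m.+1 * (esz e_upto_m + tc c_count_body + 3) +
  tc (Asg vAns (Bin OSub (Cst 1) (Bin OSub (Var vx) (Var vk)))))))))))))))).

Lemma matched_answer nb mL mR : ~ has_endangered_K3 E -> tabled nb ->
  matching nb D m 0 mL mR -> covered nb mL -> msize m mL <= k <-> bp3d_yes E k.
Proof.
move=> Hend [_ Harc] M [pk [Hpk Hcov]].
have conf u : 0 < u <= m -> mL u <> 0 -> conflict E u (mL u).
  by move=> Hu u0; case: (matchL M Hu u0) => Ha _ _; exact/Harc.
split=> [Hk|].
  apply: (deletion_of_cover wfE conf Hpk) => // e x Hc.
  have [He _] := conflict_range Hc.
  by apply: Hcov => //; exact/Harc.
apply: (matching_le_deletion wfE conf) => u v Hu Hv u0 Euv.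
have v0 : mL v <> 0 by rewrite -Euv.
have [_ <- _] := matchL M Hu u0; rewrite Euv.
by have [_ -> _] := matchL M Hv v0.
Qed.

Lemma program_spec s : ~ has_endangered_K3 E -> start s ->
  spec V B raw program s program_time (fun s' => vr s' vAns = 1 <-> bp3d_yes E k).
Proof.
move=> Hend H; have HV := V_lin.
apply: spec_seq (init_spec H) _ => {s H} s H.
apply: spec_seq (copy_spec H) _ => {s H} s H.
apply: spec_seq (sqrt_spec H) _ => {s H} s [h1 h2 h3 h4].
apply: (@spec_seq _ _ _ _ _ _ _ _ _ (fun s =>
  [/\ env T s, vr s vi = 0, loaded s, ar s aA =1 (fun=> 0) & zeros s])).
  by apply: wpS; rewrite /=; conj => //; lia.
move=> {h1 h2 h3 h4} {}s H.
apply: spec_seq (adj_spec H) _ => {s H} s [h1 h2 h3 h4].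
apply: (@spec_seq _ _ _ _ _ _ _ _ _ (fun s =>
  [/\ env T s, vr s vi = 0, loaded s, adj n E m (ar s aA) & zeros s])).
  by apply: wpS; rewrite /=; conj => //; lia.
move=> {h1 h2 h3 h4} {}s H.
apply: spec_seq (fill_spec H) _ => {s H} s [h1 h2 h3].
set nb := ar s aN in h2.
apply: (@spec_seq _ _ _ _ _ _ _ _ _ (fun s =>
  [/\ env T s, ar s aN = nb, zeros s, vr s vu = 0 & vr s vs = 0])).
  by apply: wpS; rewrite /=; conj => //; lia.
move=> {h1 h3} s1 H; apply: spec_seq (auction_spec h2 H) _ => {s1 H} s1 [h1 h3 h4 h5].
apply: (@spec_seq _ _ _ _ _ _ _ _ _ (fun s => [/\ env T s, ar s aN = nb,
  matching nb D m 0 (ar s aL) (ar s aR), near_optimal nb (ar s aL) & vr s vgo = 1])).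
  by apply: wpS; rewrite /=; conj => //; lia.
move=> {h1 h3 h4 h5} {}s1 H; apply: spec_seq (rounds_spec h2 H) _ => {s1 H} s1 [h1 h3 h4 h5].
set mL := ar s1 aL in h4 h5.
apply: (@spec_seq _ _ _ _ _ _ _ _ _ (fun s =>
  [/\ env T s, ar s aL = mL, vr s vi = 0 & vr s vx = 0])).
  by apply: wpS; rewrite /=; conj => //; lia.
move=> {h1 h3} s2 H; apply: spec_seq (count_spec H) _ => {s2 H} s2 [[_ _ c3 _ _] h1].
apply: wpS; rewrite /= c3 h1; split; first by conj; lia.
rewrite -(matched_answer Hend h2 h4 h5); lia.
Qed.


End Verification.

(** * Running time and bootstrapping *)

Section Domination.
Context (g : nat -> seq edge -> nat).

(** Big O with one constant for all instances; demanding [n] and [m] positive lets [g] absorb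
    constants. *)
Definition dominated (t : nat -> seq edge -> nat) : Prop :=
  exists C, forall n E, 0 < n -> 0 < size E -> t n E <= C * g n E.

Lemma dominated_add t u : dominated t -> dominated u ->
  dominated (fun n E => t n E + u n E).
Proof.
move=> [C HC] [C' HC']; exists (C + C') => n E Hn Hm.
by rewrite mulnDl leq_add ?HC ?HC'.
Qed.

Lemma dominated_scale t c : dominated t -> dominated (fun n E => t n E * c).
Proof.
move=> [C HC]; exists (C * c) => n E Hn Hm.
by rewrite mulnAC leq_mul2r HC ?orbT.
Qed.

Lemma dominated_const c : (forall n E, 0 < n -> 0 < size E -> 0 < g n E) ->
  dominated (fun _ _ => c).
Proof. by move=> H; exists c => n E Hn Hm; rewrite leq_pmulr ?H. Qed.

End Domination.

Lemma round_time_dominated :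
  dominated (fun n E => n * size E) (fun n E => esz (Var vgo) + round_time n E + 3).
Proof.
have P (n : nat) (E : seq edge) : 0 < n -> 0 < size E -> 0 < n * size E.
  by move=> ? ?; rewrite muln_gt0; apply/andP.
rewrite /round_time.
(* The time is split along sums and constant factors; what remains are the iteration counts of the
   loops. *)
repeat (apply: dominated_add || apply: dominated_scale || exact: dominated_const P).
- by exists 2 => n E Hn Hm; nia.
- exists 10 => n E Hn Hm; have := P n E Hn Hm.
  have : n <= n * size E by rewrite leq_pmulr.
  have : size E <= n * size E by rewrite leq_pmull.
  have -> : 2 * size E * (2 * n).+1 = 4 * (n * size E) + 2 * size E by nia.
  by lia.
- by exists 3 => n E Hn Hm; nia.
Qed.

Lemma program_time_dominated :
  dominated (fun n E => n * size E * (Nat.sqrt (size E) + 1)) program_time.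
Proof.
have P (n : nat) (E : seq edge) : 0 < n -> 0 < size E ->
    0 < n * size E * (Nat.sqrt (size E) + 1).
  by move=> ? ?; rewrite !muln_gt0 addn1; apply/andP; split=> //; apply/andP.
have Pm (n : nat) (E : seq edge) : 0 < n -> 0 < size E ->
    size E <= n * size E * (Nat.sqrt (size E) + 1).
  by move=> ? ?; rewrite mulnAC leq_pmull // muln_gt0 addn1 andbT.
rewrite /program_time /auction_time.
repeat (apply: dominated_add || apply: dominated_scale || exact: dominated_const P).
1-4: by exists 1 => n E Hn Hm; rewrite mul1n; exact: Pm.
- by exists 2 => n E Hn Hm; have := P n E Hn Hm; have := Pm n E Hn Hm; lia.
- exists 2 => n E Hn Hm; have := P n E Hn Hm.
  have : n * size E <= n * size E * (Nat.sqrt (size E) + 1) by rewrite leq_pmulr ?addn1.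
  by rewrite (mulnC (size E) n); lia.
- exists 8 => n E Hn Hm; have := P n E Hn Hm; have := Pm n E Hn Hm.
  rewrite addn1; set T := _.+1.
  have : n * size E <= n * size E * T by rewrite leq_pmulr.
  have : size E * T <= n * size E * T by rewrite -mulnA leq_pmull.
  have -> : size E * (T * (2 * n).+1 + 2 * n) =
      2 * (n * size E * T) + size E * T + 2 * (n * size E) by nia.
  lia.
- have [C HC] := round_time_dominated; exists (2 * C) => n E Hn Hm.
  apply: leq_trans (leq_mul (leqnn _) (HC n E Hn Hm)) _.
  rewrite addn1; set T := _.+1; nia.
- by exists 2 => n E Hn Hm; have := P n E Hn Hm; have := Pm n E Hn Hm; lia.
Qed.

(** * Moving the input out of the register area *)

Definition boot_save (l : seq nat) : seq instr :=
  flatten [seq [:: IAdd 1 1 0; IStore 1 x] | x <- l].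

(* [1024 * m] exceeds every address of the input and of the registers, and is computed in place. *)
Definition boot : seq instr :=
  nseq 10 (IAdd 1 1 1) ++ [:: IStore 1 0; IConst 0 stride; IAdd 1 1 0]
  ++ boot_save (iota 2 (nregs - 2))
  ++ [:: IConst 0 ((nregs - 1) * stride); ISub base_reg 1 0; IConst 0 1024; IDiv 1 base_reg 0]
  ++ [:: IConst 0 stride; IAdd 0 0 base_reg; IStore 0 1; IConst 0 0].

Lemma run_double W j M : M 1 * 2 ^ j < W ->
  exists M', [/\ run_line W (nseq j (IAdd 1 1 1)) M = Some M',
    M' 1 = M 1 * 2 ^ j & forall y, y <> 1 -> M' y = M y].
Proof.
elim: j M => [|j IH] M /=; first by exists M; rewrite muln1.
move=> HW; have E1 : (M 1 + M 1) * 2 ^ j = M 1 * 2 ^ j.+1.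
  by rewrite addnn -mul2n expnS; lia.
have H1 : M 1 + M 1 < W.
  apply: leq_ltn_trans HW; rewrite -E1 leq_pmulr // expn_gt0 //.
rewrite H1; have [|M' [R1 R2 R3]] := IH (upd M 1 (M 1 + M 1)).
  by rewrite upd_same E1.
exists M'; split=> //; first by rewrite R2 upd_same E1.
by move=> y Hy; rewrite R3 // upd_other.
Qed.

Section Boot.
Context (n : nat) (E : seq edge) (k W B : nat).
Local Notation m := (size E).
Local Notation raw := (input n E k).
Lemma raw_out x : 3 * m + 3 <= x -> raw x = 0.
Proof.
rewrite /input /encode => Hx.
have -> : (x == 0) = false by lia.
have -> : (x == 1) = false by lia.
have -> : (x == 2) = false by lia.
by case: ltnP => //; lia.
Qed.

Context (m_gt0 : 0 < m) (BE : B = 1024 * m) (W_large : B + nregs * stride + n + m + k + 1 < W).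

Lemma raw_lt x : wf_graph n E -> raw x < W.
Proof. by move=> wfE; apply: leq_ltn_trans (input_le k wfE x) _; lia. Qed.

(* The first [j] cells of the input, except cell 1, have been copied to array 0, whose base is [B]. *)
Record saved (j : nat) (M : nat -> nat) : Prop := Saved {
  sv_step : M 0 = stride;
  sv_addr : M 1 + stride = B + j * stride;
  sv_copy : forall x, x < j -> x <> 1 -> M (x * stride + B) = raw x;
  sv_rest : forall y, 2 <= y -> (forall x, x < j -> y <> x * stride + B) -> M y = raw y
}.

(** Cell 1 is the moving destination and cell 0 the step. All destinations are at least [B], above
    the registers, so a cell still holds its input when its turn comes. *)
Lemma run_save i j M : wf_graph n E -> 2 <= j -> j + i <= nregs -> saved j M ->
  exists2 M', run_line W (boot_save (iota j i)) M = Some M' & saved (j + i) M'.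
Proof.
move=> wfE; elim: i j M => [|i IH] j M Hj Hji S /=.
  by exists M; rewrite ?addn0.
case: (S) => s0 s1 s2 s3.
have E1 : M 1 + M 0 = j * stride + B by rewrite s0 s1 addnC.
have Hja : j < j * stride + B by rewrite /stride; lia.
have j40 : j < 40 by move: Hji; rewrite /nregs; lia.
have W1 : M 1 + M 0 < W by rewrite E1; move: W_large; rewrite /nregs /stride in Hji *; lia.
rewrite W1 upd_same.
have Mj : upd M 1 (M 1 + M 0) j = raw j.
  rewrite upd_other; last by lia.
  by apply: s3 => // x Hx; rewrite /stride; lia.
rewrite Mj raw_lt // E1.
have [|||M' R S'] := IH j.+1 (upd (upd M 1 (j * stride + B)) (j * stride + B) (raw j)) _ _ _.
- by lia.
- by lia.
- split.
  + by rewrite !upd_other //; lia.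
  + rewrite upd_other; last by lia.
    by rewrite upd_same mulSn; lia.
  + move=> x Hx x1; rewrite updE; case: eqP => [Ex|Ex].
      by have -> : x = j by move: Ex; rewrite /stride; lia.
    rewrite upd_other; last by lia.
    by apply: s2 => //; have : x <> j by [move=> Exj; case: Ex; rewrite Exj]; lia.
  + move=> y Hy Hn; rewrite !upd_other; [|by lia|exact: Hn].
    by apply: s3 => // x Hx; apply: Hn; lia.
by exists M' => //; rewrite -addSnnS.
Qed.

(** The pointer destroys [m] in cell 1. Subtracting the known offset from its final value gives [B],
    and [B %/ 1024] restores [m]; entry 1 of array 0, skipped so far, is therefore written last. *)
Lemma run_boot : wf_graph n E ->
  exists M, [/\ run_line W boot raw = Some M, M 0 = 0, M 1 = m, M base_reg = B &
    (forall x, x < nregs -> M (x * stride + B) = raw x) /\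
    (forall y, 2 <= y -> y <> base_reg -> (forall x, x < nregs -> y <> x * stride + B) ->
      M y = raw y)].
Proof.
move=> wfE; have r1 : raw 1 = m by [].
have [|M1 [R1 V1 P1]] := @run_double W 10 raw.
  by rewrite r1 (_ : 2 ^ 10 = 1024) //; move: W_large; rewrite /nregs /stride; lia.
have {}V1 : M1 1 = B by rewrite V1 r1 BE mulnC.
pose M2 := upd (upd (upd M1 B (raw 0)) 0 stride) 1 (B + stride).
have R2 : run_line W [:: IStore 1 0; IConst 0 stride; IAdd 1 1 0] M1 = Some M2.
  have KW : stride < W by move: W_large; rewrite /nregs /stride; lia.
  have BW : B + stride < W by move: W_large; rewrite /nregs /stride; lia.
  rewrite /= P1 // raw_lt // KW V1 upd_same.
  have -> : upd (upd M1 B (raw 0)) 0 stride 1 = B by rewrite !upd_other //; lia.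
  by rewrite BW.
have S2 : saved 2 M2.
  split.
  - by rewrite /M2 upd_other // upd_same.
  - by rewrite /M2 upd_same; lia.
  - move=> x Hx x1; have -> : x = 0 by lia.
    rewrite /M2 mul0n add0n upd_other; last by lia.
    by rewrite upd_other ?upd_same //; lia.
  - move=> y Hy Hn; have := Hn 0 isT; rewrite mul0n add0n => Hy0.
    by rewrite /M2 !upd_other ?P1 //; lia.
have [||M3 R3 [s0 s1 s2 s3]] := @run_save (nregs - 2) 2 M2 wfE _ _ S2; [by []|by []|].
rewrite -[2 + _]/nregs in s1 s2 s3.
have {}s1 : M3 1 = B + (nregs - 1) * stride by move: s1; rewrite /nregs /stride; lia.
pose M4 := upd (upd (upd (upd M3 0 ((nregs - 1) * stride)) base_reg B) 0 1024) 1 m.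
pose M5 := upd (upd (upd (upd M4 0 stride) 0 (stride + B)) (stride + B) m) 0 0.
have w4 : stride < W by move: W_large; rewrite /nregs /stride; lia.
have w5 : stride + B < W by move: W_large; rewrite /nregs /stride; lia.
have w3 : m < W by lia.
have R4 : run_line W [:: IConst 0 ((nregs - 1) * stride); ISub base_reg 1 0; IConst 0 1024;
    IDiv 1 base_reg 0] M3 = Some M4.
  have w1 : (nregs - 1) * stride < W by move: W_large; rewrite /nregs /stride; lia.
  have w2 : 1024 < W by lia.
  have w6 : B < W by lia.
  have B_div : B %/ 1024 = m by rewrite BE mulKn.
  rewrite /= w1 upd_same (upd_other _ _ (_ : 1 <> 0)) // s1 addnK w6 w2.
  by rewrite upd_same (upd_other _ _ (_ : base_reg <> 0)) // upd_same B_div w3.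
have M4N : M4 base_reg = B by rewrite /M4 upd_other // upd_other // upd_same.
have R5 : run_line W [:: IConst 0 stride; IAdd 0 0 base_reg; IStore 0 1; IConst 0 0] M4 = Some M5.
  have w7 : 0 < W by lia.
  rewrite /= w4 upd_same (upd_other _ _ (_ : base_reg <> 0)) //.
  rewrite M4N.
  rewrite w5 upd_same !(upd_other _ _ (_ : 1 <> 0)) //.
  have -> : M4 1 = m by rewrite /M4 upd_same.
  by rewrite w3 w7.
exists M5; split.
- by rewrite /boot run_line_cat R1 [obind _ _]run_line_cat R2 [obind _ _]run_line_cat R3
    [obind _ _]run_line_cat R4.
- by rewrite /M5 upd_same.
- by rewrite /M5 !(upd_other _ _ (_ : 1 <> 0)) // upd_other /M4 ?upd_same //; rewrite /stride; lia.
- rewrite /M5 (upd_other _ _ (_ : base_reg <> 0)) // upd_other;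
    last by rewrite /base_reg /stride; lia.
  exact: M4N.
have keep y : 2 <= y -> y <> base_reg -> y <> stride + B -> M5 y = M3 y.
  by move=> y2 yN yB; rewrite /M5 /M4 !upd_other //; lia.
split=> [x Hx|y y2 yN Hn].
- case: (x =P 1) => [->|x1].
    by rewrite mul1n /M5 upd_other ?upd_same //; lia.
  by rewrite keep ?s2 //; rewrite /base_reg /stride; lia.
- rewrite keep ?s3 //.
  by have := Hn 1 isT; rewrite mul1n.
Qed.

End Boot.

(** * Assembling the machine program *)

Lemma exec_steps P W t pc M pc' M' fuel :
  steps P W t pc M pc' M' -> nth IHalt P pc' = IHalt -> t < fuel ->
  exec P W fuel pc M = Some M'.
Proof.
move=> H Hh Ht; have -> : fuel = t + (fuel - t).-1.+1 by lia.
by rewrite H /= Hh.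
Qed.

(** The leading jump diverts edgeless instances, whose answer is always yes: there [B] would be 0
    and the arrays would overlap the registers. *)
Lemma solver_code : exists P h, let pc := 1 + size boot in
  [/\ nth IHalt P 0 = IJz 1 h.+1, code_at P 1 boot, code_at P pc (ccmd program pc),
      h = pc + size (ccmd program pc)
    & code_at P h [:: IHalt; IConst 0 1; IHalt]].
Proof.
set pc := 1 + _; set h := pc + size (ccmd program pc).
pose P := [:: IJz 1 h.+1] ++ boot ++ ccmd program pc ++ [:: IHalt; IConst 0 1; IHalt].
have : code_at P 0 P by move=> i _; rewrite add0n.
rewrite {2}/P => /code_at_cat[H0 /code_at_cat[H1 /code_at_cat[H2 H3]]].
by exists P, h; split=> //; exact: H0 0 isT.
Qed.

(** The value bound is N^8, in which N^6 >= 3^6 exceeds the factor 64. The word bound N^24 leaves a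
    further factor N^16, at least 3^8 = [2187 * 3], for addresses. *)
Lemma expn_large N c : 3 <= N -> 24 <= c ->
  [/\ 64 * (N * N) <= N ^ 8, N <= N ^ 8
    & N ^ 8 * stride + stride + 1024 * N + nregs * stride + N < N ^ c].
Proof.
move=> HN Hc; have N0 : 0 < N by lia.
have pw a b : a <= b -> N ^ a <= N ^ b by move=> H; rewrite leq_pexp2l.
have H3 a : 3 ^ a <= N ^ a by case: a => // a; rewrite leq_exp2r.
split.
- have -> : N ^ 8 = N ^ 6 * (N * N) by rewrite -[N * N]/(N ^ 2) -expnD.
  by rewrite leq_mul2r; apply/orP; right; apply: leq_trans (H3 6).
- by rewrite -{1}(expn1 N); exact: pw.
- apply: leq_trans (pw 24 c Hc).
  have -> : N ^ 24 = N ^ 16 * N ^ 8 by rewrite -expnD.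
  have h8 : N <= N ^ 8 by rewrite -{1}(expn1 N); exact: pw.
  have h16 : 2187 * 3 <= N ^ 16 by apply: leq_trans (H3 8) (pw 8 16 _).
  have : (2187 * 3) * N ^ 8 <= N ^ 16 * N ^ 8 by rewrite leq_mul2r h16 orbT.
  by rewrite /stride /nregs; lia.
Qed.

Lemma bp3d_yes_empty E k : size E = 0 -> bp3d_yes E k.
Proof.
by move/size0nil=> ->; exists [::]; split=> // u v w [_ _ _ [b1 [b2 []]]].
Qed.

Theorem theorem2 :
  exists (P : seq instr) (c : nat),
    forall (n : nat) (E : seq edge) (k : nat),
      wf_graph n E -> ~ has_endangered_K3 E ->
      exists M' : nat -> nat,
        exec P ((n + size E + k + 2) ^ c)
             (c * (n * size E * (Nat.sqrt (size E) + 1) + n + size E + 1))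
             0 (encode n E k) = Some M'
        /\ (M' 0 = 1 <-> bp3d_yes E k).
Proof.
have [C HC] := program_time_dominated.
have [P [h [Cjz Cboot Cbody Eh Chalt]]] := solver_code.
(* [C] pays for the compiled program and [size boot] for the bootstrap; 24 serves as exponent of the
   word size and covers the few remaining steps. *)
exists P, (C + size boot + 24) => n E k wfE Hend.
set c := C + size boot + 24; set N := n + size E + k + 2.
set X := n * size E * _.
have HX : C * X + size boot + 24 <= c * (X + n + size E + 1) by rewrite /c; nia.
set fuel := c * _ in HX *.
have [m0|m_gt0] := posnP (size E).
  have W1 : 1 < N ^ c by rewrite -{1}(exp1n c) ltn_exp2r /N /c; lia.
  exists (upd (encode n E k) 0 1); split.
    have Hjz := steps_jz (N ^ c) (encode n E k) Cjz.
    rewrite -[encode n E k 1]/(size E) m0 eqxx in Hjz.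
    have Hc : code_at P h.+1 [:: IConst 0 1]
      by case=> // _; rewrite addn0 -(addn1 h); exact: Chalt 1 isT.
    have Hone : run_line (N ^ c) [:: IConst 0 1] (encode n E k) = Some (upd (encode n E k) 0 1).
      by rewrite /= W1.
    apply: exec_steps (steps_trans Hjz (steps_line Hc Hone)) _ _; last by rewrite /=; lia.
    by rewrite /= addSnnS; exact: Chalt 2 isT.
  split=> [_|_]; [exact: bp3d_yes_empty|exact: upd_same].
set W := N ^ c; set V := N ^ 8; have [B BE] : exists B, B = 1024 * size E by eexists.
have N3 : 3 <= N by rewrite /N; lia.
have [|V1 V2 V3] := expn_large (c := c) N3; first by rewrite /c; lia.
rewrite -/V -/W in V1 V2 V3.
have BN : B <= 1024 * N by rewrite BE /N leq_mul2l; lia.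
have W_large : B + nregs * stride + n + size E + k + 1 < W by move: V3; rewrite /N; lia.
have [M [RB M0 M1 MB [Mc Mr]]] := run_boot m_gt0 BE W_large wfE.
have B_RR : nregs <= B by rewrite /nregs; lia.
have inV x : input n E k x < V.
  by apply: leq_ltn_trans (input_le k wfE x) _; apply: leq_trans V2; rewrite /N; lia.
have Mraw x : nregs <= x < B -> M x = input n E k x.
  by move=> Hx; apply: Mr; move: Hx; rewrite /nregs /base_reg; lia.
(* The input ends below [B], so the array area is still zero except for the cells saved by the
   bootstrap. *)
have Marr a i : a < stride -> M (i * stride + a + B) =
    if (a == 0) && (i < nregs) then input n E k i else 0.
  move=> Ha; case: ifP => [/andP[/eqP-> Hi]|Hn]; first by rewrite addn0 Mc.
  rewrite Mr; [|by lia|by move: B_RR; rewrite /nregs /base_reg; lia|].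
    by apply: raw_out; lia.
  move=> x Hx Ex; have [a0 ix] : a = 0 /\ i = x by move: Ex Ha; rewrite /stride; lia.
  by rewrite a0 ix eqxx Hx in Hn.
(* Most variables start with leftover input; [start] fixes none but [vm], as the program assigns the
   others before reading them. *)
pose s := State M (fun a i => M (i * stride + a + B)).
have R : rel V B (input n E k) s M.
  split=> // [x Hx|a i Ha].
    case: (x =P 0) => [->|x0]; first by rewrite /= M0; exact: leq_ltn_trans (inV 0).
    case: (x =P 1) => [->|x1]; first by rewrite /= M1; exact: inV 1.
    rewrite /= Mr //; [lia|by lia|].
    by move=> y _; move: Hx B_RR; rewrite /base_reg /nregs; lia.
  rewrite /= Marr //; case: ifP => _; first exact: inV.
  exact: leq_ltn_trans (inV 0).
have S : start n E k s.
  have z a : 0 < a < stride -> ar s a =1 (fun=> 0).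
    case/andP=> a0 aK i; rewrite /= Marr //.
    by rewrite -[a == 0]negbK -lt0n a0.
  split=> //; [|exact: z|by split; apply: z].
  by move=> x Hx; rewrite /= Marr // Hx.
have [t [s' [Hev Ht Hans]]] := program_spec wfE m_gt0 V1 (eq_leq (esym BE)) Hend S.
have KV : stride < V.
  have : 0 < N * N by rewrite muln_gt0 (ltn_trans _ N3).
  by move: V1; rewrite /stride; lia.
have VW : V * stride + stride + B < W by lia.
have [M' [Hsteps R']] := ccmd_correct B_RR KV VW Hev program_wf Cbody R.
exists M'; split; last by rewrite (rel_var R').
have n_pos : 0 < n.
  by have [] := @ed_lt n E wfE 1 (introT andP (conj isT m_gt0)); lia.
have Ht' : t <= C * X by apply: leq_trans Ht (HC n E n_pos m_gt0).
have Hjz := steps_jz W (encode n E k) Cjz.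
rewrite -[encode n E k 1]/(size E) (gtn_eqF m_gt0) in Hjz.
have Hs := steps_trans Hjz (steps_trans (steps_line Cboot RB) Hsteps).
apply: exec_steps Hs _ _; last by lia.
by rewrite -Eh -[h]addn0; exact: Chalt 0 isT.
Qed.
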